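(* Let $1\le q<+\infty$ and $1\le p<+\infty$. Let $\{u_k\}_{k\in\mathbb{N}}$ be a bounded sequence in $L^q(\Omega;\mathbb{R}^m)$ and $\{w_k\}_{k\in\mathbb{N}}$ a bounded sequence in $L^p(\Omega;\mathbb{R}^{m\times n})$. Then there is a (non-relabeled) subsequence $\{(u_k,w_k)\}$ generating measures $(\sigma,\hat\nu,\hat\mu)$ in the $p$-sense and $(\sigma^*,\hat\nu^*,\hat\mu^* )$ in the $q$-sense (as defined in the context), and in addition, for every $h_0^{(1)},h_0^{(2)}\in C(\bar\Omega\times\beta_{\mathcal{U}}\mathbb{R}^m\times\beta_{\mathcal{R}}\mathbb{R}^{m\times n})$, $$\begin{aligned}&\lim_{k\to\infty}\int_\Omega\Big(h_0^{(1)}(x,u_k(x),w_k(x))(1+|w_k(x)|^p)+h_0^{(2)}(x,u_k(x),w_k(x))(1+|u_k(x)|^q)\Big)\,dx\\&\quad=\int_{\bar\Omega}\int_{\beta_{\mathcal{R}}\mathbb{R}^{m\times n}}\int_{\beta_{\mathcal{U}}\mathbb{R}^m}h_0^{(1)}(x,r,s)\,\hat\mu_{s,x}(dr)\,\hat\nu_x(ds)\,\sigma(dx)\\&\qquad+\int_{\bar\Omega}\int_{\beta_{\mathcal{R}}\mathbb{R}^{m\times n}}\int_{\beta_{\mathcal{U}}\mathbb{R}^m}h_0^{(2)}(x,r,s)\,\hat\mu^*_{s,x}(dr)\,\hat\nu^*_x(ds)\,\sigma^*(dx).\end{aligned}$$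
   Context: $\Omega\subset\mathbb{R}^n$ is a bounded domain with Lipschitz boundary, $m,n\ge1$. A complete ring of bounded continuous real functions on a Euclidean space $E$ is a ring of bounded continuous functions $E\to\mathbb{R}$ that contains the constants, separates points from closed subsets, and is closed in the supremum norm. A separable complete ring corresponds to a metrizable compactification of $E$ (a compact metrizable space into which $E$ is embedded homeomorphically and densely; $E$ is identified with its image) such that the elements of the ring are exactly the functions having a (unique) continuous extension to the compactification; the extension is denoted by the same symbol. $\mathcal{U}$ is a separable complete ring on $\mathbb{R}^m$ with compactification $\beta_{\mathcal{U}}\mathbb{R}^m$, and $\mathcal{R}$ is a separable complete ring on $\mathbb{R}^{m\times n}$ with compactification $\beta_{\mathcal{R}}\mathbb{R}^{m\times n}$. In both triples below, the first entry ($\sigma$ or $\sigma^*$) is a positive finite Radon measure on $\bar\Omega$; the second ($\hat\nu$ or $\hat\nu^*$) is a weakly* measurable family of probability measures on $\beta_{\mathcal{R}}\mathbb{R}^{m\times n}$ parametrized by $x\in\bar\Omega$ (defined $\sigma$-a.e., resp. $\sigma^*$-a.e.); the third ($\hat\mu$ or $\hat\mu^*$) is a weakly* measurable family of probability measures on $\beta_{\mathcal{U}}\mathbb{R}^m$ parametrized by $(x,s)\in\bar\Omega\times\beta_{\mathcal{R}}\mathbb{R}^{m\times n}$ (defined a.e. with respect to $\hat\nu_x(ds)\sigma(dx)$, resp. $\hat\nu^*_x(ds)\sigma^*(dx)$). Weakly* measurable means that integrals of fixed continuous functions are measurable functions of the parameter. $\{(u_k,w_k)\}$ generates $(\sigma,\hat\nu,\hat\mu)$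 in the $p$-sense if for all $g\in C(\bar\Omega)$, $f_0\in\mathcal{U}$, $\psi_0\in\mathcal{R}$, with $\psi(s):=\psi_0(s)(1+|s|^p)$, $$\lim_{k\to\infty}\int_\Omega g(x)f_0(u_k(x))\psi(w_k(x))\,dx=\int_{\bar\Omega}\int_{\beta_{\mathcal{R}}\mathbb{R}^{m\times n}}\int_{\beta_{\mathcal{U}}\mathbb{R}^m}g(x)f_0(r)\psi_0(s)\,\hat\mu_{s,x}(dr)\hat\nu_x(ds)\sigma(dx).$$ $\{(u_k,w_k)\}$ generates $(\sigma^*,\hat\nu^*,\hat\mu^* )$ in the $q$-sense if for all $g\in C(\bar\Omega)$, $f_0\in\mathcal{U}$, $\psi_0\in\mathcal{R}$, with $f(r):=f_0(r)(1+|r|^q)$, $$\lim_{k\to\infty}\int_\Omega g(x)f(u_k(x))\psi_0(w_k(x))\,dx=\int_{\bar\Omega}\int_{\beta_{\mathcal{R}}\mathbb{R}^{m\times n}}\int_{\beta_{\mathcal{U}}\mathbb{R}^m}g(x)f_0(r)\psi_0(s)\,\hat\mu^*_{s,x}(dr)\hat\nu^*_x(ds)\sigma^*(dx).$$ *)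

(* Defs.v *)
From HB Require Import structures.
From mathcomp Require Import all_boot all_order all_algebra.
From mathcomp Require Import all_classical all_reals all_analysis.
From mathcomp Require Import measurable_realfun ring lra.
Set Implicit Arguments.
Unset Strict Implicit.
Unset Printing Implicit Defensive.
Import Order.TTheory GRing.Theory Num.Theory.
Import numFieldNormedType.Exports.
Local Open Scope classical_set_scope.
Local Open Scope ring_scope.

Notation borel T := (g_sigma_algebraType (@open T)).

(* Lebesgue measure on R^n (row vectors, Borel sigma-algebra): the image of the
   product of the Lebesgue measure on R with the one on R^(n-1). *)
Section lebesgue_rV.
Context {R : realType}.

Definition row_cons n (xv : R * 'rV[R]_n) : 'rV[R]_n.+1 :=
  \row_i if unlift ord0 i is Some j then xv.2 0 j else xv.1.

Definition row_uncons n (v : 'rV[R]_n.+1) : R * 'rV[R]_n :=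
  (v 0 0, \row_i v 0 (lift ord0 i)).

Lemma row_consK n : cancel (@row_cons n) (@row_uncons n).
Proof.
move=> [x v]; rewrite /row_uncons mxE unlift_none; congr pair.
by apply/rowP => i; rewrite !mxE liftK.
Qed.

Lemma measurable_coord n (i : 'I_n) :
  measurable_fun setT ((fun v => v 0 i) : borel 'rV[R]_n -> R).
Proof.
apply: (measurability _ (RGenOpens.measurableE R)).
move=> _ [_ [a [b ->]] <-]; apply: sub_sigma_algebra; rewrite setTI.
have /continuousP := @coord_continuous R 1 n 0 i.
by apply; exact: interval_open.
Qed.

Lemma measurable_fun_rV d (T : measurableType d) n (f : T -> borel 'rV[R]_n) :
  (forall i, measurable_fun setT ((fun t => (f t : 'rV[R]_n) 0 i) : T -> R)) ->
  measurable_fun setT f.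
Proof.
move=> mf; apply: (@measurability _ _ T (borel _) setT f (@open 'rV[R]_n)) => //.
move=> _ [A oA <-]; rewrite setTI.
pose box (cr : 'rV[rat]_n * rat) : set 'rV[R]_n :=
  [set v | forall i, v 0 i \in `]ratr (cr.1 0 i) - ratr cr.2,
                                  ratr (cr.1 0 i) + ratr cr.2[ ].
have -> : A = \bigcup_(cr in [set cr | box cr `<=` A]) box cr.
  apply/seteqP; split => [v Av|v [cr /= + bv]]; last exact.
  have [e /= e0 eA] : exists2 e : R, 0 < e & ball v e `<=` A.
    by apply/nbhs_ballP; exact: open_nbhs_nbhs.
  have /rat_in_itvoo[r] : 0 < e / 2 by rewrite divr_gt0.
  rewrite in_itv/= => /andP[r0 re].
  have q i : {q : rat | ratr q \in `]v 0 i - ratr r, v 0 i + ratr r[ }.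
    by apply: cid; apply: rat_in_itvoo; rewrite ltrD2l gtrN.
  exists (\row_i sval (q i), r) => [w|i] /=; last first.
    by rewrite mxE; case: (q i) => /= z; rewrite !in_itv/=; lra.
  move=> bw; apply: eA; split => // i j; rewrite ord1.
  have /= := bw j; rewrite mxE; case: (q j) => /= z.
  by rewrite !in_itv/= /ball/= ltr_norml; lra.
rewrite preimage_bigcup bigcup_mkcond.
apply: countable_bigcupT_measurable => [|cr]; first exact: countableP.
case: ifPn => // _.
rewrite (_ : _ @^-1` _ = \bigcap_(i in [set: 'I_n]) ((fun t => f t 0 i) @^-1`
  [set` `]ratr (cr.1 0 i) - ratr cr.2, ratr (cr.1 0 i) + (ratr cr.2 : R)[ ])).
  apply: fin_bigcap_measurable => // i _.
  by rewrite -[X in measurable X]setTI; exact: mf.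
by apply/seteqP; split => t /= h i; [move=> _|]; exact: h.
Qed.

Lemma measurable_row_cons n :
  measurable_fun setT (@row_cons n : R * borel 'rV[R]_n -> borel 'rV[R]_n.+1).
Proof.
apply: measurable_fun_rV => i; case: (unliftP ord0 i) => [j|] ->.
  under eq_fun do rewrite mxE liftK.
  exact: measurableT_comp (measurable_coord j) measurable_snd.
by under eq_fun do rewrite mxE unlift_none; exact: measurable_fst.
Qed.

Lemma measurable_row_uncons n :
  measurable_fun setT (@row_uncons n : borel 'rV[R]_n.+1 -> R * borel 'rV[R]_n).
Proof.
apply: measurable_fun_pair; first exact: measurable_coord.
apply: measurable_fun_rV => i; under eq_fun do rewrite mxE.
exact: measurable_coord.
Qed.


Section step.
Variables (n : nat) (mu : {sigma_finite_measure set (borel 'rV[R]_n) -> \bar R}).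

Definition lebesgue_step : set (borel 'rV[R]_n.+1) -> \bar R :=
  pushforward (@lebesgue_measure R \x mu)%E (@row_cons n : _ -> borel 'rV[R]_n.+1).

Let canon : {measure set (borel 'rV[R]_n.+1) -> \bar R} :=
  measure_function_pushforward__canonical__measure_function_Measure
    (@lebesgue_measure R \x mu)%E (@measurable_row_cons n).

HB.instance Definition _ := Measure.copy lebesgue_step canon.

Let lebesgue_step_sigma_finite : sigma_finite setT lebesgue_step.
Proof.
have /sigma_finiteP[F [TF ndF Foo]] := sigma_finiteT (@lebesgue_measure R).
have /sigma_finiteP[G [TG ndG Goo]] := sigma_finiteT mu.
exists (fun k => @row_uncons n @^-1` (F k `*` G k)) => [|k].
  rewrite -preimage_bigcup (_ : \bigcup_k _ = setT) ?preimage_setT//.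
  rewrite -subTset => -[x y] _.
  have [i _ Fx] : (\bigcup_k F k) x by rewrite -TF.
  have [j _ Gy] : (\bigcup_k G k) y by rewrite -TG.
  exists (maxn i j) => //; split => /=.
    by move: Fx; exact/subsetPset/ndF/leq_maxl.
  by move: Gy; exact/subsetPset/ndG/leq_maxr.
have [[mF Fk] [mG Gk]] := (Foo k, Goo k); split.
  rewrite -[X in measurable X]setTI; apply: measurable_row_uncons => //.
  exact: measurableX.
rewrite /lebesgue_step /pushforward -comp_preimage.
rewrite (_ : _ \o _ = id); last by apply/funext => xv; exact: row_consK.
by rewrite [ltLHS]product_measure1E// lte_mul_pinfty// ge0_fin_numE.
Qed.

HB.instance Definition _ := Measure_isSigmaFinite.Build _ _ _ lebesgue_step
  lebesgue_step_sigma_finite.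

End step.

Fixpoint lebesgue_rV n : {sigma_finite_measure set (borel 'rV[R]_n) -> \bar R} :=
  if n is n'.+1 then lebesgue_step (lebesgue_rV n')
  else \d_(0 : borel 'rV[R]_0).

Lemma lebesgue_rV_box n (A : 'I_n -> set R) : (forall i, measurable (A i)) ->
  lebesgue_rV n [set v | forall i, A i (v 0 i)] =
  (\prod_(i < n) lebesgue_measure (A i))%E.
Proof.
elim: n A => [|n IHn] A mA.
  by rewrite big_ord0 /= diracE mem_set// => -[].
rewrite big_ord_recl -IHn => [|i]; last exact: mA.
have mB : measurable
    ([set v | forall i, A (lift ord0 i) ((v : 'rV[R]_n) 0 i)] :
      set (borel 'rV[R]_n)).
  rewrite (_ : [set v | _] = \bigcap_(i in [set: 'I_n])
      ((fun v : borel 'rV[R]_n => (v : 'rV[R]_n) 0 i) @^-1` A (lift ord0 i))).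
    apply: fin_bigcap_measurable => // i _.
    by rewrite -[X in measurable X]setTI; exact: measurable_coord.
  by apply/seteqP; split => v /= h i; [move=> _|]; exact: h.
rewrite -[RHS]product_measure1E //=; last exact: mA.
congr (product_measure1 _ _ _); apply/seteqP; split => -[x v] /=.
  move=> h; split=> [|i]; first by have := h ord0; rewrite mxE unlift_none.
  by have := h (lift ord0 i); rewrite mxE liftK.
move=> [A0 h] i; rewrite mxE.
by case: (unliftP ord0 i) => [j|] -> //=; exact: h.
Qed.

End lebesgue_rV.

Section domain.
Context {R : realType} {n : nat}.
Implicit Types Omega : set 'rV[R]_n.

(* Near each boundary point and in suitable orthonormal coordinates, Omega is
   the strict epigraph of a Lipschitz function of the n - 1 coordinates other
   than the i-th one ([col' i y] deletes the i-th entry of y). *)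
Definition lipschitz_boundary Omega :=
  forall x0, (closure Omega `\` Omega°) x0 ->
  exists (Q : 'M[R]_n) (i : 'I_n) (gamma : 'rV[R]_n.-1 -> R^o),
    [/\ Q *m Q^T = 1%:M, lipschitz gamma &
        \forall x \near x0,
          Omega x <-> gamma (col' i (x *m Q)) < (x *m Q) ord0 i].

Definition bounded_lipschitz_domain Omega :=
  [/\ Omega !=set0, open Omega, connected Omega, bounded_set Omega &
      lipschitz_boundary Omega].

End domain.

(* The Euclidean norm; the library norm on matrices is the maximum norm. *)
Definition enorm {R : realType} {a b : nat} (s : 'M[R]_(a, b)) : R :=
  Num.sqrt (\sum_i \sum_j s i j ^+ 2).

Definition bounded_in_Lp {R : realType} {n a b : nat} (Omega : set 'rV[R]_n)
    (r : R) (v : nat -> 'rV[R]_n -> 'M[R]_(a, b)) :=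
  (forall k, measurable_fun (Omega : set (borel 'rV[R]_n))
               (v k : borel 'rV[R]_n -> borel 'M[R]_(a, b))) /\
  exists M : R, forall k,
    ('N[lebesgue_rV n]_(r%:E)[(fun x => (enorm (v k x))%:E) \_ Omega]
      <= M%:E)%E.

Section complete_rings.
Context {R : realType} {E : topologicalType}.
Implicit Types A : set (E -> R).

Definition separates_points_from_closed A :=
  forall (x : E) (C : set E), closed C -> ~ C x ->
    exists2 f, A f & ~ closure (f @` C) (f x).

Definition complete_ring A :=
  [/\ forall f, A f -> continuous f /\ bounded_fun (f : E -> R^o),
      forall c, A (cst c),
      forall f g, A f -> A g -> A (f - g) /\ A (f * g),
      separates_points_from_closed A &
      closed (A : set {uniform E -> R})].

Definition separable_ring A :=
  exists D : set (E -> R), [/\ countable D, D `<=` A &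
    A `<=` closure (D : set {uniform E -> R})].

(* A Hausdorff pseudometric space is a metric space. *)
Definition metrizable_compactification (K : pseudoPMetricType R) (e : E -> K) :=
  [/\ compact [set: K], hausdorff_space K, injective e, 
      forall U : set E, open U <-> exists2 V : set K, open V & e @^-1` V = U &
      dense (range e)].

Definition compactification_of A (K : pseudoPMetricType R) (e : E -> K) :=
  metrizable_compactification e /\
  forall f : E -> R, A f <-> exists2 F : K -> R, continuous F & F \o e = f.

(* The continuous extension of f to K (unique, since e has dense range). *)
Definition extension (K : pseudoPMetricType R) (e : E -> K) (f : E -> R) :
    K -> R :=
  xget (cst 0) [set F : K -> R | continuous F /\ F \o e = f].

End complete_rings.

Section triples.
Context {R : realType} {n : nat} (Omega : set 'rV[R]_n).
Context (KU KR : pseudoPMetricType R).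

(* A triple (sigma, nu, mu). The measure sigma on the closure of Omega is a
   measure on R^n vanishing off that closure (finite Borel measures on a compact
   metric space are Radon). The families, defined only almost everywhere, are
   represented by everywhere defined ones. *)
Record measure_triple := MeasureTriple {
  mt_sigma : {finite_measure set (borel 'rV[R]_n) -> \bar R} ;
  mt_nu : 'rV[R]_n -> probability (borel KR) R ;
  mt_mu : 'rV[R]_n -> KR -> probability (borel KU) R ;
  mt_sigma_closure : mt_sigma (~` closure Omega) = 0%E ;
  mt_nu_measurable : forall h : KR -> R, continuous h ->
    measurable_fun (closure Omega : set (borel 'rV[R]_n))
      (fun x => \int[mt_nu x]_s h s) ;
  mt_mu_measurable : forall h : KU -> R, continuous h ->
    measurable_fun
      (closure Omega `*` setT : set (borel 'rV[R]_n * borel KR))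
      (fun xs => \int[mt_mu xs.1 xs.2]_r h r) }.

Definition triple_integral (t : measure_triple) (h : 'rV[R]_n -> KU -> KR -> R)
    : R :=
  \int[mt_sigma t]_(x in closure Omega)
    \int[mt_nu t x]_s \int[mt_mu t x s]_r h x r s.

End triples.

Section generation.
Context {R : realType} {m n : nat} (Omega : set 'rV[R]_n).
Context (ringU : set ('rV[R]_m -> R)) (ringR : set ('M[R]_(m, n) -> R)).
Context {KU KR : pseudoPMetricType R}.
Context (eU : 'rV[R]_m -> KU) (eR : 'M[R]_(m, n) -> KR).
Context (u : nat -> 'rV[R]_n -> 'rV[R]_m) (w : nat -> 'rV[R]_n -> 'M[R]_(m, n)).

Definition generates_p (p : R) (t : measure_triple Omega KU KR) :=
  forall (g : 'rV[R]_n -> R) f0 psi0,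
    {within closure Omega, continuous g} -> ringU f0 -> ringR psi0 ->
    (fun k => \int[lebesgue_rV n]_(x in Omega)
       (g x * f0 (u k x) * (psi0 (w k x) * (1 + enorm (w k x) `^ p))))
      @ \oo -->
    triple_integral t (fun x r s => g x * extension eU f0 r * extension eR psi0 s).

Definition generates_q (q : R) (t : measure_triple Omega KU KR) :=
  forall (g : 'rV[R]_n -> R) f0 psi0,
    {within closure Omega, continuous g} -> ringU f0 -> ringR psi0 ->
    (fun k => \int[lebesgue_rV n]_(x in Omega)
       (g x * (f0 (u k x) * (1 + enorm (u k x) `^ q)) * psi0 (w k x)))
      @ \oo -->
    triple_integral t (fun x r s => g x * extension eU f0 r * extension eR psi0 s).

End generation.

(* Main.v *)
Require Import Defs.
From HB Require Import structures.
From mathcomp Require Import all_boot all_order all_algebra.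
From mathcomp Require Import all_classical all_reals all_analysis.
From mathcomp Require Import measurable_realfun ring lra.
Set Implicit Arguments.
Unset Strict Implicit.
Unset Printing Implicit Defensive.
Import Order.TTheory GRing.Theory Num.Theory.
Import numFieldNormedType.Exports.
Local Open Scope classical_set_scope.
Local Open Scope ring_scope.

(**
The maps z_k(x) = (x, eU (u_k x), eR (w_k x)) send Omega into the compact space
Z = closure Omega x KU x KR, and the densities 1 + |w_k|^p and 1 + |u_k|^q have
bounded integrals over Omega. The images under z_k of these two densities are
therefore measures of bounded mass on Z. The theorem says that along a
subsequence both converge weakly and that the limits can be disintegrated, first
over x and then over (x, s). Everything else is a special case: generation in
the p-sense and in the q-sense is the convergence tested with the functions
g(x) f0(r) psi0(s), where f0 and psi0 stand for their extensions, and the last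
limit is the sum of the two convergences.

Both the weak limit and the disintegration are built by hand from one device.
Choose a sequence of open sets E_i of a compact pseudometric space, for instance
the balls around finite nets, such that points with the same first bits
[z \in E_i] are close to each other ([exists_coding]). A finite word b of bits
then stands for a [cell], and a finite measure gives a tree of weights: the mass
of a cell is the sum of the masses of the two cells into which the next bit
splits it. Conversely, given a tree of weights a, cut the interval [0, a(empty
word)[ into two consecutive intervals of lengths a(0) and a(1), cut these again,
and so on. A number t then selects an infinite word, hence a point T(t) in the
closure of all the cells of that word ([walk]), and the numbers that select a
given initial word b fill an interval of length a(b).

- Weak limit ([weak_limit]): a diagonal argument ([diagonal_subsequence]) makes
  the masses of all cells converge, and the limits form a tree of weights. A
  continuous function is almost constant on deep cells ([coded_approx]), so its
  integrals converge to its integral along T. The limit weights need not be the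
  masses of the cells for the limit measure, since mass may move to the boundary
  of a cell; for this reason T is only asked to stay in the closures of cells.

- Disintegration ([disintegration]): for a law of pairs (X, Y), the conditional
  mass of {Y in cell b} given X = x is a Radon-Nikodym density. For almost every
  x these densities form a tree of weights of total mass 1, so the same
  construction gives a jointly measurable T(x, t) such that (x, T(x, t)) has the
  law of (X, Y) when x has the law of X and t is uniform on [0, 1[. The law of
  T(x, .) is the fibre over x, and integration over the fibres is Fubini's
  theorem. Two applications, to s given x and to r given (x, s), produce the
  triples ([triple_of_law]).

These ingredients are assembled in [weak_compactness], where both densities are
treated along the same subsequence.
*)

(** * Binary codes of points *)

(* Matrices and products of pointed pseudometric spaces are again pointed
   pseudometric spaces. *)
HB.saturate matrix.
HB.saturate prod.

Section coding.
Context {R : realType} {Z : pseudoPMetricType R}.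
Implicit Types (D : set Z) (E : nat -> set Z) (b : seq bool).

(** The newest bit is at the head, so that refining a cell means consing. *)
Fixpoint code E j (z : Z) : seq bool :=
  if j is i.+1 then `[< E i z >] :: code E i z else [::].

Lemma size_code E j z : size (code E j z) = j.
Proof. by elim: j => //= j ->. Qed.

Lemma eq_code E i j x y : (i <= j)%N -> code E j x = code E j y ->
  code E i x = code E i y.
Proof.
move=> /subnKC <-; elim: (j - i)%N => [|k IHk]; first by rewrite addn0.
by rewrite addnS /= => -[_ /IHk].
Qed.

Lemma eq_codeP E j x y :
  code E j x = code E j y <-> forall i, (i < j)%N -> (E i x <-> E i y).
Proof.
elim: j => [|j IHj] /=; first by split.
split=> [[Ej /IHj H] i|H].
  rewrite ltnS leq_eqVlt => /predU1P[->|]; last exact: H.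
  by split=> h; apply/asboolP; [rewrite -Ej|rewrite Ej]; apply/asboolP.
congr cons; first by apply/asbool_equiv_eq/H.
by apply/IHj => i ij; apply: H; rewrite ltnS ltnW.
Qed.

Definition cell D E b : set Z := [set z | D z /\ code E (size b) z = b].

Lemma cell0 D E : cell D E [::] = D.
Proof. by apply/seteqP; split => z // []. Qed.

Lemma cell_code D E j z : D z -> cell D E (code E j z) z.
Proof. by move=> Dz; rewrite /cell/= size_code. Qed.

Lemma cell_cons D E c b :
  cell D E (c :: b) = [set z | cell D E b z /\ `[< E (size b) z >] = c].
Proof.
apply/seteqP; split => z /=; first by move=> [Dz [Ez bz]].
by move=> [[Dz bz] Ez]; split=> //; rewrite /= Ez bz.
Qed.

Lemma sub_cell D E c b : cell D E (c :: b) `<=` cell D E b.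
Proof. by rewrite cell_cons => z []. Qed.

Lemma cellU D E b : cell D E b = cell D E (false :: b) `|` cell D E (true :: b).
Proof.
rewrite !cell_cons; apply/seteqP; split => z /=; last by move=> [[]|[]].
by case: asboolP => h Cz; [right|left].
Qed.

Lemma cell_disj D E b : cell D E (false :: b) `&` cell D E (true :: b) = set0.
Proof.
by rewrite !cell_cons -subset0 => z /= [[_ ->] []].
Qed.

(** The infinite words, presented by their finite initial parts. *)
Definition coherent (c : nat -> seq bool) :=
  c 0%N = [::] /\ forall j, exists i, c j.+1 = i :: c j.

Lemma cell_mono D E c i j : coherent c -> (i <= j)%N ->
  cell D E (c j) `<=` cell D E (c i).
Proof.
move=> [_ cS] /subnKC <-; elim: (j - i)%N => [|k IHk]; first by rewrite addn0.
by rewrite addnS; have [h ->] := cS (i + k)%N; apply: subset_trans IHk; exact: sub_cell.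
Qed.

(** This makes the words a uniform parametrization of [D]: long words determine
    a point up to a small error. *)
Definition small_cells D E := forall e : R, 0 < e ->
  exists j, forall x y, D x -> D y -> code E j x = code E j y -> ball x e y.

Lemma size_coherent c j : coherent c -> size (c j) = j.
Proof.
move=> [c0 cS]; elim: j => [|j IHj]; first by rewrite c0.
by have [i ->] := cS j; rewrite /= IHj.
Qed.

Lemma coherent_code E z : coherent (code E ^~ z).
Proof. by split => // j; eexists. Qed.

(** Closures are taken because a nested sequence of nonempty cells of a compact
    set need not have a common point, whereas their closures do. *)
Definition follows D E (c : nat -> seq bool) z :=
  D z /\ forall j, closure (cell D E (c j)) z.

Lemma follows_code D E z : D z -> follows D E (code E ^~ z) z.
Proof. by move=> Dz; split => // j; exact/subset_closure/cell_code. Qed.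

Definition inside D E (U : set Z) b := closure (cell D E b) `<=` U.

Lemma inside_cons D E U i b : inside D E U b -> inside D E U (i :: b).
Proof. by apply: subset_trans; apply: closure_subset; exact: sub_cell. Qed.

Lemma small_cell_closure D E : small_cells D E -> forall e : R, 0 < e ->
  exists j, forall b, (j <= size b)%N -> forall x y,
    closure (cell D E b) x -> closure (cell D E b) y -> ball x e y.
Proof.
move=> sm e e0; have e3 : 0 < e / 3 by lra.
have [j smj] := sm _ e3; exists j => b jb x y clx cly.
have [x' [[Dx' bx'] xx']] := clx _ (nbhsx_ballx x _ e3).
have [y' [[Dy' by'] yy']] := cly _ (nbhsx_ballx y _ e3).
have -> : e = e / 3 + e / 3 + e / 3 by lra.
apply: ball_triangle (ball_sym yy'); apply: ball_triangle xx' _.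
by apply: smj => //; apply: eq_code jb _; rewrite bx'.
Qed.

(** Membership in an open set is decided by finitely many bits, since the
    closed cells along an infinite word shrink to the point. All measurability
    statements about points given by words come from this. *)
Lemma open_followsP D E c z U : small_cells D E -> coherent c ->
  follows D E c z -> open U -> U z <-> exists j, inside D E U (c j).
Proof.
move=> sm cc [Dz fz] oU; split=> [Uz|[j]]; last exact.
have /nbhs_ballP[e /= e0 eU] := open_nbhs_nbhs (conj oU Uz).
have [j jb] := small_cell_closure sm e0; exists j => y cly; apply: eU => /=.
by apply: jb (fz j) cly; rewrite size_coherent.
Qed.

Lemma inside_mono D E c U i j : coherent c -> (i <= j)%N ->
  inside D E U (c i) -> inside D E U (c j).
Proof.
move=> [_ cS] /subnKC <-; elim: (j - i)%N => [|k IHk]; first by rewrite addn0.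
by move=> /IHk; rewrite addnS; have [h ->] := cS (i + k)%N; exact: inside_cons.
Qed.

(** A cluster point of a choice of one point in each of the nested cells. *)
Lemma exists_follows D E c : compact D -> coherent c ->
  (forall j, cell D E (c j) !=set0) -> exists z, follows D E c z.
Proof.
move=> cD cc ne; pose s j := xget point (cell D E (c j)).
have sc j : cell D E (c j) (s j) by exact: (xgetPex _ (ne j)).
have [] := cD (s @ \oo).
  by exists 0%N => // j _; have [] := sc j.
move=> z [Dz cz]; exists z; split => // j B /cz; apply.
exists j => //= i /= /subnKC <-.
by apply: (cell_mono cc) (leq_addr _ _) _ (sc _).
Qed.

End coding.

(** * Maps given by words *)
Section measurability.
Context {R : realType} {Z : pseudoPMetricType R} {D : set Z} {E : nat -> set Z}.
Context d {S : measurableType d} (A : set S) (c : S -> nat -> seq bool).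
Context (y : S -> Z).
Hypothesis sm : small_cells D E.
Hypothesis cc : forall s, coherent (c s).
Hypothesis mc : forall b, measurable (A `&` [set s | c s (size b) = b]).
Hypothesis fy : forall s, A s -> follows D E (c s) (y s).

Let pre U j : set S := A `&` [set s | inside D E U (c s j)].

Let preE U j : pre U j =
  \bigcup_(b in [set b : j.-tuple bool | inside D E U b])
     (A `&` [set s | c s (size b) = b]).
Proof.
apply/seteqP; split => s.
  move=> [As Us]; have jt : size (c s j) == j by rewrite (size_coherent _ (cc s)).
  by exists (Tuple jt) => //=; rewrite (eqP jt).
by move=> [b /= Ub] [As]; rewrite size_tuple => cb; split => //=; rewrite cb.
Qed.

Let mpre U j : measurable (pre U j).
Proof.
rewrite preE; apply: fin_bigcup_measurable; first exact: finite_finset.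
by move=> b _; exact: mc.
Qed.

Let preU U : open U -> A `&` y @^-1` U = \bigcup_j pre U j.
Proof.
move=> oU; apply/seteqP; split => s.
  by move=> [As /(open_followsP sm (cc s) (fy As) oU)[j ?]]; exists j.
by move=> [j _ [As Uj]]; split => //; apply/(open_followsP sm (cc s) (fy As) oU); exists j.
Qed.

(** By [open_followsP] the preimage of an open set is a countable union of sets
    on which an initial part of the word is prescribed. *)
Lemma measurable_follows : measurable_fun A (y : S -> borel Z).
Proof.
move=> mA; apply: (@measurability _ _ S (borel Z) A y (@open Z)) => //.
move=> _ [U oU <-]; rewrite (preU oU); exact: bigcupT_measurable.
Qed.

(** The image of [mu] under [y] is determined on open sets by the measures of
    the events that prescribe initial words: they exhaust the preimage from
    below. Two maps whose words have the same law thus have the same law. *)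
Lemma cvg_law_follows (mu : {measure set S -> \bar R}) U : open U ->
  ((fun j => \sum_(b \in [set b : j.-tuple bool | inside D E U b])
    mu (A `&` [set s | c s (size b) = b])) @ \oo --> mu (A `&` y @^-1` U))%E.
Proof.
move=> oU; rewrite (preU oU).
have -> : (fun j => \sum_(b \in [set b : j.-tuple bool | inside D E U b])
    mu (A `&` [set s | c s (size b) = b]))%E = mu \o pre U.
  apply/funext => j /=; rewrite preE measure_fin_bigcup//; first exact: finite_finset.
  move=> b b' _ _.
  move=> [s [[_ sb] [_ sb']]]; apply: val_inj => /=.
  by move: sb sb'; rewrite !size_tuple => <- <-.
apply: nondecreasing_cvg_mu => //; first exact: bigcupT_measurable.
move=> i j ij; apply/subsetPset => s [As]; split => //.
exact: (inside_mono (cc s) ij).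
Qed.

End measurability.

(** * Trees of weights and subdivision of intervals *)
Section bits.
Context {R : realType}.
Implicit Types (a : seq bool -> R) (b : seq bool) (t : R).

Definition tree_weights a :=
  (forall b, 0 <= a b) /\ forall b, a b = a (false :: b) + a (true :: b).

(** At each step the interval of [b] is split into the interval of [false :: b],
    on the left, and the interval of [true :: b], on the right. *)
Fixpoint left_end a b : R :=
  if b is i :: b' then left_end a b' + (if i then a (false :: b') else 0) else 0.

Fixpoint bits a t j : seq bool :=
  if j is j'.+1 then
    let b := bits a t j' in (left_end a b + a (false :: b) <= t) :: b
  else [::].

Lemma coherent_bits a t : coherent (bits a t).
Proof. by split => // j; eexists. Qed.

Lemma bits_bound a t j : tree_weights a -> 0 <= t < a [::] ->
  left_end a (bits a t j) <= t < left_end a (bits a t j) + a (bits a t j).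
Proof.
move=> [a0 aD] t0; elim: j => [|j /=]; first by rewrite /= add0r.
set b := bits a t j => /andP[tb1 tb2]; have ab := aD b.
by have [tb|tb] := leP (left_end a b + a (false :: b)) t; rewrite ?addr0; lra.
Qed.

Lemma left_end_bound a b : tree_weights a ->
  0 <= left_end a b /\ left_end a b + a b <= a [::].
Proof.
move=> [a0 aD]; elim: b => [|i b /= [l0 lb]]; first by rewrite /= add0r.
by have := a0 (i :: b); have := a0 (false :: b); have := a0 (true :: b);
  have := aD b; case: i; lra.
Qed.

(** The numbers that select the word [b] form an interval of length [a b], which
    is why Lebesgue measure realizes the weights. *)
Lemma bitsE a t b : tree_weights a -> 0 <= t < a [::] ->
  bits a t (size b) = b <-> left_end a b <= t < left_end a b + a b.
Proof.
move=> wa t0; split=> [bE|].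
  by have := bits_bound (size b) wa t0; rewrite bE.
elim: b => [//|i b /= IHb h]; have [a0 aD] := wa.
have := a0 (false :: b); have := a0 (true :: b); have ab := aD b => a1 a2.
have E : bits a t (size b) = b by apply: IHb; case: (i) h; lra.
rewrite E; congr cons.
by case: i h => h; [apply/idP|apply/negbTE; rewrite -ltNge]; lra.
Qed.

End bits.

Lemma measurable_between {R : realType} d (S : measurableType d) (f g h : S -> R) :
  measurable_fun setT f -> measurable_fun setT g -> measurable_fun setT h ->
  measurable [set s | f s <= g s < h s].
Proof.
move=> mf mg mh.
have mb : measurable_fun setT (fun s => (f s <= g s) && (g s < h s)).
  by apply: measurable_and; [exact: measurable_fun_ler|exact: measurable_fun_ltr].
by rewrite -[X in measurable X]setTI; exact: (mb measurableT [set true]).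
Qed.

(** The weights depend measurably on a parameter [x : P]; the constant case is
    used for the weak limit, the general one for the disintegration. *)
Section walk.
Context {R : realType} {Z : pseudoPMetricType R} {D : set Z} {E : nat -> set Z}.
Context d {P : measurableType d} (a : P -> seq bool -> R).
Hypothesis cD : compact D.
Hypothesis sm : small_cells D E.
Hypothesis wa : forall x, tree_weights (a x).
Hypothesis ma : forall b, measurable_fun setT (a ^~ b).
Hypothesis a_cell : forall x b, cell D E b = set0 -> a x b = 0.

Definition walk_dom : set (P * measurableTypeR R) := [set xt | 0 <= xt.2 < a xt.1 [::]].

Definition walk (xt : P * measurableTypeR R) : Z :=
  if 0 <= xt.2 < a xt.1 [::]
  then xget point (follows D E (bits (a xt.1) xt.2)) else point.

(** Words of zero weight are never selected, so the selected cells are nonempty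
    and there is a point to choose. *)
Lemma walk_follows xt : walk_dom xt ->
  follows D E (bits (a xt.1) xt.2) (walk xt).
Proof.
case: xt => x t; rewrite /walk_dom /walk /= => tx; rewrite tx.
apply: xgetPex; apply: exists_follows => // [|j]; first exact: coherent_bits.
apply/set0P/eqP => /(a_cell x) a0.
by have := bits_bound j (wa x) tx; rewrite a0; lra.
Qed.

Let mleft b : measurable_fun setT (fun x => left_end (a x) b).
Proof.
elim: b => [|i b IHb] /=; first exact: measurable_cst.
by apply: measurable_funD => //; case: i => //.
Qed.

Lemma measurable_walk_dom : measurable walk_dom.
Proof.
apply: (@measurable_between R _ (P * measurableTypeR R)%type (cst 0) snd
  (fun xt => a xt.1 [::])) => //.
exact: measurableT_comp (ma _) measurable_fst.
Qed.

Lemma walk_bitsE b : walk_dom `&` [set xt | bits (a xt.1) xt.2 (size b) = b] =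
  [set xt | left_end (a xt.1) b <= xt.2 < left_end (a xt.1) b + a xt.1 b].
Proof.
apply/seteqP; split => xt /=.
  by move=> [xt0 /(bitsE _ (wa xt.1) xt0)].
move=> h; have xt0 : walk_dom xt.
  by have := left_end_bound b (wa xt.1); rewrite /walk_dom /=; lra.
by split => //; apply/bitsE.
Qed.

Lemma measurable_walk_bits b :
  measurable (walk_dom `&` [set xt | bits (a xt.1) xt.2 (size b) = b]).
Proof.
have ml : measurable_fun setT (fun xt : P * measurableTypeR R => left_end (a xt.1) b).
  exact: measurableT_comp (mleft b) measurable_fst.
rewrite walk_bitsE; apply: (measurable_between ml measurable_snd).
by apply: measurable_funD => //; exact: measurableT_comp (ma _) measurable_fst.
Qed.

(** The point is chosen non-constructively, but it follows a word that depends
    measurably on the data, and this suffices. *)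
Lemma measurable_walk : measurable_fun setT (walk : P * measurableTypeR R -> borel Z).
Proof.
rewrite -(setvU walk_dom); apply/measurable_funU => //.
- by apply: measurableC; exact: measurable_walk_dom.
- exact: measurable_walk_dom.
split.
  apply: (eq_measurable_fun (cst point : P * measurableTypeR R -> borel Z));
    last exact: measurable_cst.
  by move=> xt; rewrite inE /walk_dom /walk /= => /negP/negbTE ->.
apply: (@measurable_follows _ _ D E _ _ _ (fun xt => bits (a xt.1) xt.2)) => //.
- by move=> xt; exact: coherent_bits.
- exact: measurable_walk_bits.
- exact: walk_follows.
Qed.

End walk.

(** * Laws, and the uniform distribution *)
Section law.
Context d d' {S : measurableType d} {T : measurableType d'} {R : realType}.
Context (X : S -> T) (mX : measurable_fun setT X).

(** The measurability proof is an argument so that the image measure inherits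
    the structure of finite measure or probability from [mu]. *)
Definition law (mu : {measure set S -> \bar R}) of measurable_fun setT X :
  set T -> \bar R := pushforward mu X.

Section measure.
Variable mu : {measure set S -> \bar R}.

Let canon : {measure set T -> \bar R} :=
  measure_function_pushforward__canonical__measure_function_Measure mu mX.

HB.instance Definition _ := Measure.copy (law mu mX) canon.
End measure.

Section finite.
Variable mu : {finite_measure set S -> \bar R}.

Let law_fin : fin_num_fun (law mu mX).
Proof.
move=> U mU; apply: fin_num_measure; rewrite -[X in measurable X]setTI.
exact: mX.
Qed.

HB.instance Definition _ := Measure_isFinite.Build _ _ _ (law mu mX) law_fin.
End finite.

Section proba.
Variable mu : probability S R.

Let law1 : law mu mX setT = 1%E.
Proof. by rewrite /law /pushforward preimage_setT; exact: probability_setT. Qed.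

HB.instance Definition _ := Measure_isProbability.Build _ _ _ (law mu mX) law1.
End proba.

End law.

(** Open sets are stable under intersection while the Borel sets of [K] are only
    generated by them: this gives the product sigma-algebra a generating
    pi-system on which laws can be compared with [cvg_law_follows]. *)
Lemma measurable_prod_open d (P : measurableType d) (K : ptopologicalType) :
  @measurable _ (P * borel K)%type =
  <<s [set A `*` B | A in @measurable _ P & B in @open K] >>.
Proof.
set G := [set _ | _ in _ & _ in _]; apply/seteqP; split; last first.
  apply: smallest_sub; first exact: sigma_algebra_measurable.
  by move=> _ [A mA [B oB <-]]; apply: measurableX => //; exact: sub_sigma_algebra.
pose GT := g_sigma_algebraType G.
have m1 : measurable_fun setT (fst : GT -> P).
  move=> _ A mA; rewrite setTI; apply: sub_sigma_algebra.
  by exists A => //; exists setT; [exact: openT|apply/seteqP; split => -[]//= x y []].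
have m2 : measurable_fun setT (snd : GT -> borel K).
  apply: (@measurability _ _ GT (borel K) setT snd (@open K)) => //.
  move=> _ [B oB <-]; rewrite setTI; apply: sub_sigma_algebra.
  by exists setT => //; exists B => //; apply/seteqP; split => -[]//= x y [].
have m3 : measurable_fun setT (fun x : GT => (x.1, x.2) : P * borel K).
  exact: (measurable_fun_pair m1 m2).
move=> C mC; have := m3 measurableT C mC; rewrite setTI.
by congr (_ _); apply/seteqP; split => -[].
Qed.

Lemma eq_law_prod {R : realType} d (P : measurableType d) (K : pseudoPMetricType R)
    (m1 : {finite_measure set (P * borel K)%type -> \bar R})
    (m2 : {measure set (P * borel K)%type -> \bar R}) :
  (forall A (U : set K), measurable A -> open U -> m1 (A `*` U) = m2 (A `*` U)) ->
  forall C, measurable C -> m1 C = m2 C.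
Proof.
move=> H; move=> C mC.
pose G : set (set (P * borel K)%type) :=
  [set A `*` B | A in @measurable _ P & B in @open K].
apply: (@measure_unique _ R (P * borel K)%type G (fun=> setT) _ _ _ _ m1 m2) => //.
- exact: measurable_prod_open.
- move=> _ _ [A mA [B oB <-]] [A' mA' [B' oB' <-]]; rewrite -setXI.
  exists (A `&` A'); first exact: measurableI.
  by exists (B `&` B') => //; exact: openI.
- by move=> _; exists setT => //; exists setT; [exact: openT|rewrite setXTT].
- by apply/seteqP; split => // x _; exists 0%N.
- by move=> _ [A mA [B oB <-]]; exact: H.
- by move=> _; rewrite ltey_eq fin_num_measure.
Qed.

(** Only the values on intervals matter, so the distribution is kept opaque. *)
Lemma unif_subproof {R : realType} : {U : probability (measurableTypeR R) R |
  forall c d : R, 0 <= c -> c <= d -> d <= 1 ->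
    U [set t | c <= t < d] = (d - c)%:E}.
Proof.
exists (uniform_prob (@ltr01 R)) => c d c0 cd d1.
rewrite /= /uniform_prob integral_uniform_pdf.
rewrite (eq_integral (fun=> 1%E)); last first.
  move=> t; rewrite inE => -[_ /=]; rewrite in_itv /= /uniform_pdf => ->.
  by rewrite subr0 invr1.
rewrite setIidl; last by move=> t /=; rewrite in_itv /=; lra.
rewrite (_ : [set t | _] = [set` `[c, d[]); last first.
  by apply/seteqP; split => t; rewrite /= in_itv.
rewrite integral_cst// mul1e /= lebesgue_measure_itv/= lte_fin.
by case: ltP => [_|dc]; rewrite -?EFinB//; congr EFin; lra.
Qed.

Definition unif {R : realType} := sval (@unif_subproof R).

Lemma unif_itv {R : realType} (c d : R) : 0 <= c -> c <= d -> d <= 1 ->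
  unif [set t | c <= t < d] = (d - c)%:E.
Proof. exact: (svalP unif_subproof). Qed.

(** * Disintegration *)
Lemma measurable_code {R : realType} {Z : pseudoPMetricType R}
    (E : nat -> set Z) d (S : measurableType d) (A : set S) (f : S -> Z) b :
  measurable A -> (forall i, measurable (A `&` f @^-1` E i)) ->
  measurable (A `&` [set s | code E (size b) (f s) = b]).
Proof.
move=> mA mE; elim: b => [|i b IHb].
  by rewrite (_ : _ `&` _ = A)//; apply/seteqP; split => s // [].
rewrite (_ : _ `&` _ = (A `&` [set s | code E (size b) (f s) = b]) `&`
    (if i then A `&` f @^-1` E (size b) else A `\` (A `&` f @^-1` E (size b)))).
  by apply: measurableI => //; case: i => //; exact: measurableD.
apply/seteqP; split => s; first move=> [As [Es bs]]; last first.
  move=> [[As bs] Es]; split => //=; rewrite bs; congr cons.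
  case: i Es => [[_ ?]|[_ nE]]; first exact/asboolP.
  by apply/asboolPn => ?; exact: nE.
split=> //; case: i Es => [/asboolP|/asboolPn] //= nE.
by split => // -[].
Qed.

Section disintegration.
Context {R : realType} d0 (S : measurableType d0).
Context (lam : {finite_measure set S -> \bar R}).
Context d (P : measurableType d) (K : pseudoPMetricType R) (E : nat -> set K).
Hypothesis cK : compact [set: K].
Hypothesis sm : small_cells setT E.
Hypothesis mE : forall i, measurable (E i : set (borel K)).
Context (X : S -> P) (Y : S -> borel K).
Hypothesis mX : measurable_fun setT X.
Hypothesis mY : measurable_fun setT Y.

Local Notation C := (cell setT E).
Local Notation sigma := (law lam mX).

Let mYC b : measurable (Y @^-1` C b).
Proof.
rewrite (_ : _ @^-1` _ = setT `&` [set s | code E (size b) (Y s) = b]).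
  by apply: measurable_code => // i; exact: mY.
by apply/seteqP; split => s [].
Qed.

Let mXA A : measurable A -> measurable (X @^-1` A).
Proof. by move=> mA; rewrite -[X in measurable X]setTI; exact: mX. Qed.

(** The density of A |-> lam (X in A, Y in cell b) with respect to the law of
    [X], that is, the conditional probability of the cell given [X]. *)
Lemma exists_cell_density b : exists f : P -> R,
  [/\ measurable_fun setT f, forall x, 0 <= f x &
      forall A, measurable A ->
        (\int[sigma]_(x in A) (f x)%:E = lam (X @^-1` A `&` Y @^-1` C b))%E].
Proof.
have fb : (lam (Y @^-1` C b) < +oo)%E by rewrite ltey_eq fin_num_measure.
have dom : law (mfrestr (mYC b) fb) mX `<< sigma.
  apply/null_content_dominatesP => A mA A0; apply/eqP.
  rewrite -measure_le0 -A0; apply: le_measure => //; rewrite ?inE.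
  - by apply: measurableI => //; exact: mXA.
  - exact: mXA.
have [f [f0 ff fi fE]] := radon_nikodym_sigma_finite dom.
exists (fine \o f); split.
- by apply: measurableT_comp => //; exact: measurable_int fi.
- by move=> x; exact: fine_ge0.
- move=> A mA; rewrite -[RHS]/(law (mfrestr (mYC b) fb) mX A) fE//.
  by apply: eq_integral => x _; rewrite /= fineK.
Qed.

Let f b := sval (cid (exists_cell_density b)).

Let mf b : measurable_fun setT (f b).
Proof. by rewrite /f; case: cid => ? []. Qed.

Let f0 b x : 0 <= f b x.
Proof. by rewrite /f; case: cid => ? []. Qed.

Let fE b A : measurable A ->
  (\int[sigma]_(x in A) (f b x)%:E = lam (X @^-1` A `&` Y @^-1` C b))%E.
Proof. by rewrite /f; case: cid => ? [? ?]; apply. Qed.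

Let fi b : sigma.-integrable setT (EFin \o f b).
Proof.
apply/integrableP; split; first exact/measurable_EFinP.
under eq_integral do rewrite /= ger0_norm//.
by rewrite fE// ltey_eq fin_num_measure//; apply: measurableI => //; exact: mXA.
Qed.

(** What a fibre needs to be a tree of weights of mass 1 charging no empty cell;
    each condition is an equality of integrals over all measurable sets, hence
    holds almost everywhere. *)
Let good b x := f b x = f (false :: b) x + f (true :: b) x /\
  (C b = set0 -> f b x = 0) /\ f [::] x = 1.

Let ae_good b : \forall x \ae sigma, good b x.
Proof.
have h1 : ae_eq sigma setT (EFin \o f b)
    (EFin \o (fun x => f (false :: b) x + f (true :: b) x)).
  apply: integral_ae_eq => //.
    exact/measurable_EFinP/measurable_funD.
  move=> A _ mA; rewrite fE//=; under [RHS]eq_integral do rewrite EFinD.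
  rewrite ge0_integralD//; first last.
  - exact/measurable_EFinP/measurable_funTS.
  - by move=> x _; rewrite lee_fin.
  - exact/measurable_EFinP/measurable_funTS.
  - by move=> x _; rewrite lee_fin.
  rewrite !fE// cellU preimage_setU setIUr measureU//.
  - by apply: measurableI => //; exact: mXA.
  - by apply: measurableI => //; exact: mXA.
  - by rewrite setIACA -[in X in _ `&` X = _]preimage_setI cell_disj preimage_set0 setI0.
have h2 : C b = set0 -> ae_eq sigma setT (EFin \o f b) (cst 0%E).
  move=> C0; apply: integral_ae_eq => //.
  by move=> A _ mA; rewrite fE// C0 preimage_set0 setI0 measure0 integral0.
have h3 : ae_eq sigma setT (EFin \o f [::]) (cst 1%E).
  apply: integral_ae_eq => //.
  move=> A _ mA; rewrite fE// cell0 preimage_setT setIT integral_cst//.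
  by rewrite mul1e.
have [C0|C0] := pselect (C b = set0).
  move: (h2 C0) h1 h3; apply: filterS3 => x /(_ I)[x1] /(_ I)[x2] /(_ I)[x3].
  by split.
by move: h1 h3; apply: filterS2 => x /(_ I)[x1] /(_ I)[x2]; split.
Qed.

(** There are countably many words, so one null set [N] contains all the bad
    points. On [N] the weights are replaced with those of the point mass at an
    arbitrary point, so that the conditions hold everywhere. *)
Lemma exists_conditional_weights : exists a : P -> seq bool -> R,
  [/\ forall x, tree_weights (a x) /\ a x [::] = 1,
      forall b, measurable_fun setT (a ^~ b),
      forall x b, C b = set0 -> a x b = 0 &
      forall b A, measurable A ->
        (\int[sigma]_(x in A) (a x b)%:E = lam (X @^-1` A `&` Y @^-1` C b))%E].
Proof.
have : \forall x \ae sigma, forall n, good (odflt [::] (unpickle n)) x.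
  by apply: ae_foralln => n; exact: ae_good.
move=> [N [mN N0 NP]].
have goodN x : ~ N x -> forall b, good b x.
  move=> Nx b; apply: contrapT => nb; apply: Nx; apply: NP => h.
  by apply: nb; have := h (pickle b); rewrite pickleK.
pose z0 : K := point.
pose a x b := if x \in N then \1_(C b) z0 else f b x.
have Dz b : \1_(C b) z0 = \1_(C (false :: b)) z0 + \1_(C (true :: b)) z0 :> R.
  rewrite (cellU setT E b) !indicE in_setU.
  have : ~ (C (false :: b) `&` C (true :: b)) z0 by rewrite cell_disj.
  have [Cf|] := boolP (z0 \in C (false :: b)); have [Ct|] := boolP (z0 \in C (true :: b)).
  - by case; split; exact: set_mem.
  - by rewrite /= addr0.
  - by rewrite /= add0r.
  - by rewrite /= addr0.
have ma b : measurable_fun setT (a ^~ b).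
  apply: measurable_fun_ifT => //.
  apply: (measurable_fun_bool true) => //.
  rewrite setTI (_ : _ @^-1` _ = N) //.
  by apply/seteqP; split => x /= => [/set_mem|/mem_set].
exists a; split.
- move=> x; rewrite /a; case: ifPn => xN; last first.
    have {}xN : ~ N x by move=> Nx; rewrite mem_set in xN.
    split; last by have [_ []] := goodN _ xN [::].
    by split=> b; [exact: f0|have [] := goodN _ xN b].
  by split; [split=> // b; exact: Dz|rewrite cell0 indicT].
- exact: ma.
- move=> x b C0; rewrite /a C0 indic0; case: ifPn => // xN.
  have {}xN : ~ N x by move=> Nx; rewrite mem_set in xN.
  by have [_ []] := goodN _ xN b; rewrite C0 => + _; apply.
- move=> b A mA; rewrite -fE//; apply: ae_eq_integral => //.
  + exact/measurable_EFinP/measurable_funTS.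
  + exact/measurable_EFinP/measurable_funTS.
  exists N; split => // x /= /not_implyP[Ax ax]; apply: contrapT => Nx; apply: ax.
  by rewrite /a memNset.
Qed.

(** The walks along weights of mass 1 are defined on this set. *)
Lemma unif_dom : (sigma \x unif)%E (~` [set xt : P * measurableTypeR R | 0 <= xt.2 < 1]) = 0%E.
Proof.
rewrite (_ : ~` _ = setT `*` ~` [set t | 0 <= t < 1]); last first.
  by apply/seteqP; split => xt //= [].
have m01 : measurable [set t : measurableTypeR R | 0 <= t < 1].
  by apply: measurable_between.
rewrite product_measure1E//; last exact: measurableC.
have u0 : unif (~` [set t : measurableTypeR R | 0 <= t < 1]) = 0%E.
  by rewrite probability_setC// unif_itv// subr0 subee.
by rewrite [X in (_ * X)%E]u0 mule0.
Qed.

(** Conditionally on [X], the words of [Y] and of [T] have the same law by the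
    choice of the weights, so both sides agree on the products of a measurable
    set and an open set, and these determine a finite measure. *)
Theorem disintegration : exists T : P * measurableTypeR R -> K,
  measurable_fun setT (T : P * measurableTypeR R -> borel K) /\
  forall B : set (P * borel K), measurable B ->
    lam [set s | B (X s, Y s)] =
    (sigma \x unif)%E [set xt | B (xt.1, T xt)].
Proof.
have [a [wa ma a0 aE]] := exists_conditional_weights.
have wa1 x : tree_weights (a x) by have [] := wa x.
have a1 x : a x [::] = 1 by have [] := wa x.
pose T := walk (D := setT) (E := E) a.
have mT : measurable_fun setT (T : P * measurableTypeR R -> borel K) by exact: measurable_walk.
exists T; split => //.
pose m : {measure set (P * measurableTypeR R)%type -> \bar R} := (sigma \x unif)%E.
have mXY : measurable_fun setT (fun s => (X s, Y s) : P * borel K).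
  exact: measurable_fun_pair.
have mxT : measurable_fun setT (fun xt => (xt.1, T xt) : P * borel K).
  exact: measurable_fun_pair.
suff H A (U : set K) : measurable A -> open U ->
    law lam mXY (A `*` U) = law m mxT (A `*` U).
  by move=> B mB; exact: (eq_law_prod H).
move=> mA oU; rewrite /law /pushforward.
pose A' : set (P * measurableTypeR R) := (fst @^-1` A) `&` walk_dom a.
have mA' : measurable A'.
  apply: measurableI; last exact: measurable_walk_dom.
  by rewrite -[X in measurable X]setTI; exact: measurable_fst.
have mU : measurable (T @^-1` U).
  rewrite -[X in measurable X]setTI; apply: mT => //.
  exact: sub_sigma_algebra.
have wdE : walk_dom a = [set xt : P * measurableTypeR R | 0 <= xt.2 < 1].
  by apply/seteqP; split => xt; rewrite /walk_dom /= a1.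
have mwd : measurable (walk_dom a) by exact: measurable_walk_dom.
have TE : m ((fun xt => (xt.1, T xt)) @^-1` (A `*` U)) =
    m (A' `&` T @^-1` U).
  have mC : measurable ((fun xt => (xt.1, T xt)) @^-1` (A `*` U)).
    rewrite -[X in measurable X]setTI; apply: mxT => //.
    by apply: measurableX => //; exact: sub_sigma_algebra.
  apply: etrans (measureDI _ mC mwd) _; rewrite [X in (X + _)%E](_ : _ = 0%E).
    rewrite add0e; congr (_ _); apply/seteqP.
    by split => xt /= [[]] //.
  apply: (@subset_measure0 _ _ _ _ _ (~` [set xt : P * measurableTypeR R | 0 <= xt.2 < 1])).
  - exact: measurableD.
  - by rewrite -wdE; exact: measurableC.
  - by rewrite -wdE => xt [].
  - exact: unif_dom.
(* Both measures of A x U are limits of the same sum over the cells inside U. *)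
have c1 : ((fun j => \sum_(b \in [set b : j.-tuple bool | inside setT E U b])
    lam (X @^-1` A `&` Y @^-1` C b)) @ \oo -->
    lam (X @^-1` A `&` Y @^-1` U))%E.
  have YC b : Y @^-1` C b = [set s | code E (size b) (Y s) = b].
    by apply/seteqP; split => s; [case|move=> h; split].
  have -> : (fun j => \sum_(b \in [set b : j.-tuple bool | inside setT E U b])
      lam (X @^-1` A `&` Y @^-1` C b))%E =
    (fun j => \sum_(b \in [set b : j.-tuple bool | inside setT E U b])
      lam (X @^-1` A `&` [set s | code E (size b) (Y s) = b]))%E.
    by apply/funext => j; apply: eq_fsbigr => b _; rewrite YC.
  have mc b : measurable (X @^-1` A `&` [set s | code E (size b) (Y s) = b]).
    by rewrite -YC; apply: measurableI; [exact: mXA|exact: mYC].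
  have cc s : coherent (code E ^~ (Y s)) by exact: coherent_code.
  have fol s : (X @^-1` A) s -> follows setT E (code E ^~ (Y s)) (Y s).
    by move=> _; exact: follows_code.
  exact: (cvg_law_follows sm cc mc fol oU).
have c2 : ((fun j => \sum_(b \in [set b : j.-tuple bool | inside setT E U b])
    lam (X @^-1` A `&` Y @^-1` C b)) @ \oo -->
    m (A' `&` T @^-1` U))%E.
  have aC b : lam (X @^-1` A `&` Y @^-1` C b) = m
      (A' `&` [set xt | bits (a xt.1) xt.2 (size b) = b]).
    rewrite -(aE b _ mA) integral_mkcond.
    (* The section over x in A is the interval of the word b, of length a x b. *)
    transitivity (\int[sigma]_x unif (xsection
      (A' `&` [set xt | bits (a xt.1) xt.2 (size b) = b]) x))%E; last exact: erefl.
    apply: eq_integral => x _.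
    rewrite patchE /A' -setIA walk_bitsE; last exact: wa1.
    case: ifPn => xA.
      have [l0 l1] := left_end_bound b (wa1 x).
      rewrite (_ : xsection _ _ =
        [set t | left_end (a x) b <= t < left_end (a x) b + a x b]).
        rewrite unif_itv; [|exact: l0| |by rewrite -(a1 x)].
          by rewrite addrAC subrr add0r.
        by rewrite lerDl; have [] := wa1 x.
      apply/seteqP; split => t; rewrite /xsection /=; first by move=> /set_mem[].
      by move=> h; apply/mem_set; split; [exact: set_mem xA|exact: h].
    rewrite (_ : xsection _ _ = set0); first by rewrite measure0.
    apply/seteqP; split => t //; rewrite /xsection /= => /set_mem[/= Ax _].
    by rewrite (mem_set Ax) in xA.
  have -> : (fun j => \sum_(b \in [set b : j.-tuple bool | inside setT E U b])
      lam (X @^-1` A `&` Y @^-1` C b))%E =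
    (fun j => \sum_(b \in [set b : j.-tuple bool | inside setT E U b])
      m (A' `&` [set xt | bits (a xt.1) xt.2 (size b) = b]))%E.
    by apply/funext => j; apply: eq_fsbigr => b _; rewrite aC.
  have mc b : measurable (A' `&` [set xt | bits (a xt.1) xt.2 (size b) = b]).
    rewrite -setIA; apply: measurableI; last exact: measurable_walk_bits.
    by rewrite -[X in measurable X]setTI; exact: measurable_fst.
  have cc (xt : P * measurableTypeR R) : coherent (bits (a xt.1) xt.2).
    exact: coherent_bits.
  have fol xt : A' xt -> follows setT E (bits (a xt.1) xt.2) (T xt).
    by move=> [_ wxt]; exact: walk_follows.
  exact: (cvg_law_follows sm cc mc fol oU).
exact: etrans (cvg_unique _ c1 c2) (esym TE).
Qed.

End disintegration.

(** * Existence of codes *)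
(** The sets are the open balls of radius 1/(n+1) around the points of finite
    nets; sharing the bits of one net puts two points in a common ball. Taking
    interiors makes the sets open, since pseudometric balls need not be. *)
Lemma exists_coding {R : realType} (Z : pseudoPMetricType R) (D : set Z) :
  compact D -> exists E, (forall i, open (E i)) /\ small_cells D E.
Proof.
rewrite compact_cover => cD.
have net n : exists s : seq Z, forall z, D z ->
    exists2 i, (i < size s)%N & (ball (nth point s i) n.+1%:R^-1)° z.
  have [|z Dz|s _ sD] := cD Z setT (fun z => (ball z n.+1%:R^-1)°).
  - by move=> z _; exact: open_interior.
  - by exists z => //; apply: nbhsx_ballx; rewrite invr_gt0.
  exists (finmap.enum_fset s) => z /sD [c /= cs cz]; exists (index c (finmap.enum_fset s)).
    by rewrite index_mem.
  by rewrite nth_index.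
pose s n := sval (cid (net n)).
have sP n z : D z ->
    exists2 i, (i < size (s n))%N & (ball (nth point (s n) i) n.+1%:R^-1)° z.
  by rewrite /s; case: cid => ? h; exact: h.
exists (fun k => if unpickle k is Some ni then
  (ball (nth point (s ni.1) ni.2) ni.1.+1%:R^-1)° else set0); split.
  by move=> k; case: unpickle => [ni|]; [exact: open_interior|exact: open0].
move=> e e0; have e2 : 0 < e / 2 by lra.
have [n _ /(_ _ (leqnn n)) /= ne] := near_infty_natSinv_lt (PosNum e2).
exists (\max_(i < size (s n)) pickle (n, val i)).+1 => x y Dx Dy xy.
have [i im xi] := sP n x Dx.
have /eq_codeP/(_ (pickle (n, i))) := xy; rewrite pickleK.
case=> [|/(_ xi) yi _]; first by rewrite ltnS; exact: (leq_bigmax (Ordinal im)).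
have -> : e = e / 2 + e / 2 by lra.
apply: (@ball_triangle _ _ (nth point (s n) i)).
  apply: ball_sym; apply: le_ball (ltW ne) _ _; exact: interior_subset xi.
by apply: le_ball (ltW ne) _ _; exact: interior_subset yi.
Qed.

(** The bits of the two factors alternate. Measurability into a product space
    is reduced to the factors by checking it on these sets. *)
Definition prod_coding {Z1 Z2 : Type} (E1 : nat -> set Z1) (E2 : nat -> set Z2) k
    : set (Z1 * Z2) :=
  if odd k then snd @^-1` E2 k./2 else fst @^-1` E1 k./2.

Lemma small_cells_prod {R : realType} (Z1 Z2 : pseudoPMetricType R)
    (D1 : set Z1) (D2 : set Z2) E1 E2 :
  small_cells D1 E1 -> small_cells D2 E2 ->
  small_cells (D1 `*` D2) (prod_coding E1 E2).
Proof.
move=> sm1 sm2 e e0; have [j1 h1] := sm1 e e0; have [j2 h2] := sm2 e e0.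
exists (maxn j1 j2).*2.+1 => -[x1 x2] [y1 y2] [Dx1 Dx2] [Dy1 Dy2].
move=> /eq_codeP H; split.
  apply: h1 => //; apply/eq_codeP => i ij; have := H i.*2.
  rewrite /prod_coding odd_double doubleK; apply.
  by rewrite ltnS leq_double ltnW// (leq_trans ij)// leq_maxl.
apply: h2 => //; apply/eq_codeP => i ij; have := H i.*2.+1.
rewrite /prod_coding /= odd_double /= uphalf_double; apply.
by rewrite ltnS ltn_double (leq_trans ij)// leq_maxr.
Qed.

(** * Approximation of integrals by sums over cells *)
Section step.
Context {R : realType} d (S : measurableType d) (mu : {measure set S -> \bar R}).
Context (I : finType) (A : set S) (beta : S -> I) (v : I -> R) (f rho : S -> R).
Hypothesis mA : measurable A.
Hypothesis mbeta : forall i, measurable (A `&` [set s | beta s = i]).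
Hypothesis mf : measurable_fun A f.
Hypothesis rho0 : forall s, A s -> 0 <= rho s.
Hypothesis irho : mu.-integrable A (EFin \o rho).

Let B i := A `&` [set s | beta s = i].

Let AE : A = \big[setU/set0]_(i <- index_enum I) B i.
Proof.
rewrite -bigcup_seq; apply/seteqP; split => s; last by move=> [i _ []].
by move=> As; exists (beta s) => //=; rewrite mem_index_enum.
Qed.

Let mB i : measurable (B i). Proof. exact: mbeta. Qed.

Let iB g i : mu.-integrable A (EFin \o g) -> mu.-integrable (B i) (EFin \o g).
Proof. by apply: (integrableS mA (mB i)) => s []. Qed.

Let int_split g : mu.-integrable A (EFin \o g) ->
  \int[mu]_(s in A) g s = \sum_i \int[mu]_(s in B i) g s.
Proof.
move=> ig; rewrite /Rintegral {1}AE integral_bigsetU_EFin//=.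
- rewrite sum_fine// => i _; by have := integrable_fin_num (mB i) (iB i ig).
- exact: (index_enum_uniq I).
- by move=> i j _ _ [s [[_ <-] [_ <-]]].
- by rewrite -AE; exact: measurable_int ig.
Qed.

(** Replace [f] with the step function [v \o beta], which differs from it by at
    most [e], and integrate against the nonnegative weight [rho]. *)
Lemma integral_step_approx (e : R) : 0 <= e ->
  (forall s, A s -> `|f s - v (beta s)| <= e) ->
  mu.-integrable A (EFin \o (fun s => f s * rho s)) /\
  `|\int[mu]_(s in A) (f s * rho s) -
     \sum_i v i * \int[mu]_(s in A `&` [set s | beta s = i]) rho s|
    <= e * \int[mu]_(s in A) rho s.
Proof.
move=> e0 fv.
have iZ c (C : set S) : measurable C -> mu.-integrable C (EFin \o rho) ->
    mu.-integrable C (EFin \o (fun s => c * rho s)).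
  by move=> mC iC; have := integrableZl mC c iC.
have mrho : measurable_fun A rho by apply/measurable_EFinP; exact: measurable_int irho.
pose M := \sum_i `|v i| + e.
have fM s : A s -> `|f s| <= M.
  move=> As; rewrite /M (bigD1 (beta s)) //=.
  have := fv s As; have := ler_normD (v (beta s)) (f s - v (beta s)).
  have : 0 <= \sum_(i | i != beta s) `|v i| by apply: sumr_ge0.
  by rewrite [v _ + _]addrC subrK; lra.
have ifr : mu.-integrable A (EFin \o (fun s => f s * rho s)).
  apply: (@le_integrable _ _ _ mu A mA _ (EFin \o (fun s => M * rho s))).
  - by apply/measurable_EFinP; exact: measurable_funM.
  - move=> s As /=; rewrite lee_fin !normrM ler_wpM2r//.
    by rewrite (le_trans (fM s As))// ler_norm.
  - exact: (iZ M _ mA irho).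
split => //; rewrite (int_split ifr) (int_split irho) mulr_sumr -sumrB.
apply: (le_trans (ler_norm_sum _ _ _)); apply: ler_sum => i _.
have ir := iB i irho; have ivr := iZ (v i) _ (mB i) ir.
rewrite -/(B i) -(RintegralZl (v i) (mB i) ir) -(RintegralB (mB i) (iB i ifr) ivr).
rewrite -(RintegralZl e (mB i) ir).
have ifv : mu.-integrable (B i) (EFin \o (fun s => f s * rho s - v i * rho s)).
  by have := integrableB (mB i) (iB i ifr) ivr.
apply: (le_trans (le_normr_Rintegral (mB i) ifv)).
apply: le_Rintegral => //.
- by have := integrable_norm ifv.
- exact: (iZ e _ (mB i) ir).
move=> s [As <-]; rewrite -mulrBl normrM (ger0_norm (rho0 As)).
by rewrite ler_wpM2r ?rho0// fv.
Qed.

End step.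

(** Heine's theorem, for a function continuous on a compact subset only. *)
Lemma compact_unif_continuous {R : realType} (Z : pseudoMetricType R) (D : set Z)
    (h : Z -> R) : compact D -> {within D, continuous h} ->
  forall e : R, 0 < e -> exists2 del : R, 0 < del &
    forall x y, D x -> D y -> ball x del y -> `|h x - h y| < e.
Proof.
move=> cD /subspace_continuousP ch e e0.
have /compact_near_coveringP/near_covering_withinP nc := cD.
pose P (del : R) x := forall y, D y -> ball x del y -> `|h x - h y| < e.
have : \forall del \near (0 : R)^'+, D `<=` P del.
  apply: nc => x Dx; have e2 : 0 < e / 2 by lra.
  have := ch x Dx; move=> /cvgrPdist_lt/(_ _ e2); rewrite near_withinE.
  move=> /nbhs_ballP[r /= r0 rh]; have r2 : 0 < r / 2 by lra.
  exists (ball x (r / 2), [set i | i < r / 2]).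
    split; first exact: nbhsx_ballx.
    by apply: nbhs_right_lt.
  move=> [x' i] [/= xx' ir] Dx' y Dy xy.
  have h1 : `|h x - h x'| < e / 2.
    by apply: rh Dx'; apply: le_ball xx'; lra.
  have h2 : `|h x - h y| < e / 2.
    apply: rh Dy; rewrite (_ : r = r / 2 + r / 2); last by lra.
    by apply: ball_triangle xx' _; apply: le_ball xy; exact: ltW.
  have -> : h x' - h y = - (h x - h x') + (h x - h y) by ring.
  by rewrite (le_lt_trans (ler_normD _ _))// normrN; lra.
move=> /(filterI (nbhs_right_gt 0))/filter_ex[del [del0 Pd]].
by exists del => // x y Dx Dy; exact: Pd.
Qed.

Lemma measurable_within_continuous {R : realType} (Z : pseudoPMetricType R)
    (D : set Z) (h : Z -> R) d (S : measurableType d) (A : set S) (y : S -> Z) :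
  {within D, continuous h} -> measurable_fun A (y : S -> borel Z) ->
  (forall s, A s -> D (y s)) -> measurable_fun A (h \o y).
Proof.
move=> ch my yD mA.
apply: (@measurability _ _ S R A (h \o y) _ (RGenOpens.measurableE R)) => //.
move=> _ [_ [a [b ->]] <-].
have oab : open [set` `]a, b[] by exact: interval_open.
have [U oU UE] := (open_subspaceP _ _).1 ((continuousP _).1 ch _ oab).
rewrite (_ : _ `&` _ = A `&` y @^-1` U).
  by apply: my => //; exact: sub_sigma_algebra.
apply/seteqP; split => s [As hs]; split => //.
  suff : (U `&` D) (y s) by case.
  by rewrite UE; split => //; exact: yD.
have : (U `&` D) (y s) by split => //; exact: yD.
by rewrite UE => -[].
Qed.

Section coded_approx.
Context {R : realType} {Z : pseudoPMetricType R} {D : set Z} {E : nat -> set Z}.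
Hypothesis cD : compact D.
Hypothesis sm : small_cells D E.

Definition rep D E b : Z := xget point (cell D E b).

Lemma repP b z : closure (cell D E b) z -> cell D E b (rep D E b).
Proof. by move=> /(_ _ filterT)[x [Cx _]]; apply: (xgetPex point); exists x. Qed.

(** The depth [j] depends on [h] and [e] alone, neither on the measure nor on
    the map: the sum over the words of length [j] approximates the integrals of
    [h] uniformly along a sequence as well as along its limit, which is what
    permits exchanging the two limits. The value of [h] on a cell is taken at a
    point of the cell. *)
Lemma coded_approx (h : Z -> R) (e : R) : {within D, continuous h} -> 0 < e ->
  exists j, forall d (S : measurableType d) (mu : {measure set S -> \bar R})
    (A : set S) (c : S -> nat -> seq bool) (y : S -> Z) (rho : S -> R),
  measurable A -> (forall s, coherent (c s)) ->
  (forall b, measurable (A `&` [set s | c s (size b) = b])) ->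
  (forall s, A s -> follows D E (c s) (y s)) ->
  (forall s, A s -> 0 <= rho s) -> mu.-integrable A (EFin \o rho) ->
  mu.-integrable A (EFin \o (fun s => h (y s) * rho s)) /\
  `|\int[mu]_(s in A) (h (y s) * rho s) - \sum_(b : j.-tuple bool)
     h (rep D E b) * \int[mu]_(s in A `&` [set s | c s (size b) = b]) rho s|
    <= e * \int[mu]_(s in A) rho s.
Proof.
move=> ch e0; have [del del0 hdel] := compact_unif_continuous cD ch e0.
have [j jdel] := small_cell_closure sm del0.
exists j => d S mu A c y rho mA cc mc fc rho0 irho.
pose beta s : j.-tuple bool := insubd (nseq_tuple j false) (c s j).
have betaE s : beta s = c s j :> seq bool.
  by rewrite /beta insubdK// -topredE /= (size_coherent _ (cc s)).
have AE (b : j.-tuple bool) :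
    A `&` [set s | c s (size b) = b] = A `&` [set s | beta s = b].
  rewrite size_tuple; apply/seteqP; split => s [As sb]; split => //=.
    by apply/val_inj => /=; rewrite betaE.
  by rewrite -betaE sb.
have mb (b : j.-tuple bool) : measurable (A `&` [set s | beta s = b]).
  by rewrite -AE; exact: mc.
have mh : measurable_fun A (fun s => h (y s)).
  apply: (measurable_within_continuous ch).
    exact: (measurable_follows sm cc mc fc).
  by move=> s /fc[].
have hb s : A s -> `|h (y s) - h (rep D E (beta s))| <= e.
  move=> As; have [Dy cy] := fc s As; have Cr := repP (cy j).
  rewrite betaE; apply/ltW/hdel => //; first by case: Cr.
  apply: (jdel (c s j)) (cy j) _; first by rewrite (size_coherent _ (cc s)).
  exact: subset_closure.
pose v (b : j.-tuple bool) := h (rep D E b).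
have [H1 H2] := integral_step_approx (v := v) mA mb mh rho0 irho (ltW e0) hb.
split=> //; rewrite (eq_bigr (fun b => v b * \int[mu]_(s in A `&` [set s | beta s = b]) rho s)) //.
by move=> b _; rewrite AE.
Qed.

End coded_approx.

(** * Weak limits from limits of the masses of cells *)
Section weak_limit.
Context {R : realType} {Z : pseudoPMetricType R} {D : set Z} {E : nat -> set Z}.
Context d {S : measurableType d} (mu : {measure set S -> \bar R}) (A : set S).
Context (y : nat -> S -> Z) (rho : nat -> S -> R) (a : seq bool -> R).
Hypothesis cD : compact D.
Hypothesis sm : small_cells D E.
Hypothesis mA : measurable A.
Hypothesis yD : forall k s, A s -> D (y k s).

Local Notation hit k b := (A `&` [set s | code E (size b) (y k s) = b]).

Hypothesis my : forall k b, measurable (hit k b).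
Hypothesis rho0 : forall k s, A s -> 0 <= rho k s.
Hypothesis irho : forall k, mu.-integrable A (EFin \o rho k).
Hypothesis rhoa : forall b, (fun k => \int[mu]_(s in hit k b) rho k s) @ \oo --> a b.

Let iB k b : mu.-integrable (hit k b) (EFin \o rho k).
Proof. by apply: (integrableS mA (my k b)) (irho k) => s []. Qed.

Let hit_cons k i b : hit k (i :: b) = hit k b `&` [set s | `[< E (size b) (y k s) >] = i].
Proof.
apply/seteqP; split => s; first by move=> [As [Ei bs]].
by move=> [[As bs] Ei]; split=> //=; rewrite Ei bs.
Qed.

Lemma limit_tree_weights : tree_weights a.
Proof.
split=> b.
  apply: (cvgr_to_ge (@rhoa b)); apply: nearW => k.
  by apply: Rintegral_ge0 => s [/rho0].
have h : (fun k => \int[mu]_(s in hit k b) rho k s) =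
  (fun k => \int[mu]_(s in hit k (false :: b)) rho k s +
            \int[mu]_(s in hit k (true :: b)) rho k s).
  apply/funext => k.
  have hU : hit k b = hit k (false :: b) `|` hit k (true :: b).
    rewrite !hit_cons -setIUr; apply/seteqP; split => s [] //.
    move=> As bs; split => //=; by case: asboolP; [right|left].
  rewrite [in LHS]hU Rintegral_setU//; first by rewrite -hU.
  apply/disj_setPS => s; rewrite !hit_cons => -[[_ /= ->] [_ /=]].
  by [].
have := @rhoa b; rewrite h => hb.
exact: (cvg_unique _ hb (cvgD (@rhoa (false :: b)) (@rhoa (true :: b)))).
Qed.

Lemma limit_empty_cell b : cell D E b = set0 -> a b = 0.
Proof.
move=> C0.
suff h : (fun k => \int[mu]_(s in hit k b) rho k s) = cst 0.
  by have := @rhoa b; rewrite h => hb; exact: (cvg_unique _ hb (cvg_cst _)).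
apply/funext => k; rewrite (_ : hit k b = set0) ?Rintegral_set0//.
apply/seteqP; split => s // [As bs].
suff : cell D E b (y k s) by rewrite C0.
by split => //; exact: yD.
Qed.

Let L := a [::].

Let mdom : measurable ([set t | 0 <= t < L] : set (measurableTypeR R)).
Proof. by apply: (@measurable_between R _ (measurableTypeR R) (cst 0) id (cst L)). Qed.

Let lebesgue_itv (c e : R) : c <= e ->
  lebesgue_measure ([set t | c <= t < e] : set (measurableTypeR R)) = (e - c)%:E.
Proof.
move=> ce; rewrite (_ : [set t | _] = [set` `[c, e[]); last first.
  by apply/seteqP; split => t; rewrite /= in_itv.
rewrite lebesgue_measure_itv/= lte_fin.
by case: ltP => [_|ec]; rewrite -?EFinB//; congr EFin; lra.
Qed.

Let dom_fin : (lebesgue_measure ([set t | (0 <= t < L)%R] : set (measurableTypeR R)) < +oo)%E.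
Proof.
rewrite lebesgue_itv ?ltry//; have [a0 _] := limit_tree_weights; exact: a0.
Qed.

Local Notation dom := ([set t | 0 <= t < L] : set (measurableTypeR R)).

Let lam : {finite_measure set (measurableTypeR R) -> \bar R} := mfrestr mdom dom_fin.

(** The limit is presented as the law of a map [T] on an interval [dom] carrying
    Lebesgue measure, namely the walk along the limit weights. *)
Lemma weak_limit : exists (lam : {finite_measure set (measurableTypeR R) -> \bar R})
    (dom : set (measurableTypeR R)) (T : measurableTypeR R -> Z),
  [/\ measurable dom, lam (~` dom) = 0%E,
      measurable_fun setT (T : measurableTypeR R -> borel Z),
      forall t, dom t -> D (T t) &
      forall h : Z -> R, {within D, continuous h} ->
        (fun k => \int[mu]_(s in A) (h (y k s) * rho k s)) @ \oo -->
        \int[lam]_(t in dom) h (T t)].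
Proof.
have wa := limit_tree_weights.
pose W (x : unit) := a.
pose T (t : measurableTypeR R) := walk (D := D) (E := E) W (tt, t).
have foll t : dom t -> follows D E (bits a t) (T t).
  move=> dt; apply: (walk_follows cD (a := W) _ _ (dt : walk_dom W (tt, t))) => //.
  by move=> ? ?; exact: limit_empty_cell.
exists lam, dom, T; split.
- exact: mdom.
- by rewrite /lam /= /mfrestr /mrestr setICl measure0.
- apply: (measurableT_comp (f := walk (D := D) (E := E) W : _ -> borel Z)).
    apply: measurable_walk => //.
    by move=> ? ?; exact: limit_empty_cell.
  exact: measurable_fun_pair.
- by move=> t /foll[].
move=> h ch; apply/cvgrPdist_le => e e0.
have a_ge0 b : 0 <= a b by have [a0 _] := wa.
have L0 : 0 <= L by exact: a_ge0.
pose e' := e / (3 * (L + 1)).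
have e'0 : 0 < e' by rewrite /e' divr_gt0//; lra.
have [j jP] := coded_approx cD sm ch e'0.
have bits_dom b : dom `&` [set t | bits a t (size b) = b] =
    [set t : measurableTypeR R | left_end a b <= t < left_end a b + a b].
  apply/seteqP; split => t; first by move=> [t0 /(bitsE b wa t0)].
  move=> tb; have [l0 l1] := left_end_bound b wa.
  have t0 : dom t by move: tb => /= tb; rewrite /L; lra.
  by split => //; exact/(bitsE b wa t0).
have mbits b : measurable (dom `&` [set t | bits a t (size b) = b]).
  rewrite bits_dom.
  exact: (@measurable_between R _ (measurableTypeR R) (cst _) id (cst _)).
have lam_bits b : lam (dom `&` [set t | bits a t (size b) = b]) = (a b)%:E.
  have [l0 l1] := left_end_bound b wa.
  rewrite /lam /= /mfrestr /mrestr setIAC setIid bits_dom lebesgue_itv.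
    by rewrite addrAC subrr add0r.
  by rewrite lerDl.
have i1 : lam.-integrable dom (EFin \o cst 1).
  apply: measurable_bounded_integrable => //.
  - by rewrite ltey_eq fin_num_measure.
  - by exists 1; split=> // x x1 t _; rewrite /= normr1 ltW.
have int_bits b :
    \int[lam]_(t in dom `&` [set t | bits a t (size b) = b]) (cst 1 : _ -> R) t = a b.
  rewrite Rintegral_cst; last exact: mbits.
  by rewrite mul1r; exact: (congr1 fine (lam_bits b)).
have [_] := jP _ _ lam dom (bits a) T (cst 1) mdom (coherent_bits a) mbits foll
  (fun _ _ => ler01) i1.
rewrite (eq_bigr (fun b : j.-tuple bool => h (rep D E b) * a b)); last first.
  by move=> b _; congr (_ * _); exact: int_bits.
have -> : \int[lam]_(s in dom) cst 1 s = L.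
  rewrite -[RHS](int_bits [::]); congr (Rintegral _ _ _).
  by apply/seteqP; split => t // [].
under eq_Rintegral do rewrite /= mulr1.
move=> H0.
have c1 : (fun k => \sum_(b : j.-tuple bool) h (rep D E b) * \int[mu]_(s in hit k b) rho k s)
    @ \oo --> \sum_(b : j.-tuple bool) h (rep D E b) * a b.
  apply: cvg_big => [|b _]; first exact: add_continuous.
  by apply: cvgM; [exact: cvg_cst|exact: rhoa].
have e3 : 0 < e / 3 by lra.
have AE k : hit k ([::] : seq bool) = A by apply/seteqP; split => s // [].
have c0 : (fun k => \int[mu]_(s in A) rho k s) @ \oo --> L.
  have := @rhoa [::]; rewrite (_ : (fun k => _) = fun k => \int[mu]_(s in A) rho k s) //.
  by apply/funext => k; rewrite AE.
(* Three errors of e / 3: two step approximations and, in between, the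
   convergence of a finite sum of masses of cells. The bound L + 1 on the total
   masses accounts for the choice of e'. *)
near=> k.
have [_ H1] := jP _ _ mu A (fun s => code E ^~ (y k s)) (y k) (rho k) mA
  (fun s => coherent_code E (y k s)) (my k)
  (fun s As => follows_code E (yD k As)) (@rho0 k) (irho k).
have H2 : `|\sum_(b : j.-tuple bool) h (rep D E b) * a b -
  \sum_(b : j.-tuple bool) h (rep D E b) * \int[mu]_(s in hit k b) rho k s| <= e / 3.
  by near: k; move/cvgrPdist_le : c1; apply.
have H3 : \int[mu]_(s in A) rho k s <= L + 1.
  by near: k; apply: (cvgr_le _ c0); rewrite ltrDl.
have H4 : e' * \int[mu]_(s in A) rho k s <= e / 3.
  apply: (@le_trans _ _ (e' * (L + 1))); first by rewrite ler_wpM2l// ltW.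
  by rewrite /e' invfM mulrA mulfVK//; lra.
have H5 : e' * L <= e / 3.
  apply: (@le_trans _ _ (e' * (L + 1))); first by rewrite ler_wpM2l; lra.
  by rewrite /e' invfM mulrA mulfVK//; lra.
move: H0 H1 H2 H4 H5; rewrite !ler_norml; lra.
Unshelve. all: by end_near.
Qed.

End weak_limit.

(** * Integrals of bounded functions *)
Section bounded_integrals.
Context {R : realType}.

Lemma bounded_integrable d (S : measurableType d) (mu : {measure set S -> \bar R})
    (f : S -> R) (C : R) : (mu setT < +oo)%E -> measurable_fun setT f ->
  (forall s, `|f s| <= C) -> mu.-integrable setT (EFin \o f).
Proof.
move=> muT mf fC; apply: measurable_bounded_integrable => //.
exists C; split=> [|M CM s _ /=]; first exact: num_real.
by rewrite (le_trans (fC s))// ltW.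
Qed.

Lemma Rintegral_law d d' (S : measurableType d) (T : measurableType d')
    (mu : {measure set S -> \bar R}) (X : S -> T) (mX : measurable_fun setT X)
    (f : T -> R) (C : R) : (mu setT < +oo)%E -> measurable_fun setT f ->
  (forall s, `|f s| <= C) -> \int[law mu mX]_t f t = \int[mu]_s f (X s).
Proof.
move=> muT mf fC; rewrite /Rintegral; congr fine.
rewrite [LHS](@integral_pushforward _ _ _ _ _ _ mX mu setT (EFin \o f))//.
- exact/measurable_EFinP.
- rewrite preimage_setT; apply: (@bounded_integrable _ _ _ (f \o X) C) => //.
    exact: measurableT_comp.
  by move=> s; exact: fC.
Qed.

Lemma Rintegral_bound d (S : measurableType d) (mu : probability S R) (f : S -> R)
    (C : R) : measurable_fun setT f -> (forall s, `|f s| <= C) ->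
  `|\int[mu]_s f s| <= C.
Proof.
move=> mf fC; have m1 : (mu setT < +oo)%E by rewrite probability_setT ltry.
have fi := bounded_integrable m1 mf fC.
apply: (le_trans (le_normr_Rintegral _ fi)) => //.
have mC : measurable_fun setT (cst C : S -> R) by exact: measurable_cst.
apply: (@le_trans _ _ (\int[mu]_s C)).
  apply: le_Rintegral => //; first by apply: (integrable_norm fi).
  by apply: (bounded_integrable (C := `|C|)).
by rewrite Rintegral_cst// [X in fine X]probability_setT mulr1.
Qed.

Lemma Rintegral_prod_unif d (P : measurableType d)
    (m : {finite_measure set P -> \bar R}) (F : P * measurableTypeR R -> R) (C : R) :
  measurable_fun setT F -> (forall z, `|F z| <= C) ->
  measurable_fun setT (fun x => \int[unif]_t F (x, t)) /\
  \int[(m \x unif)%E]_z F z = \int[m]_x \int[unif]_t F (x, t).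
Proof.
move=> mF FC.
have mT : ((m \x unif) setT < +oo)%E.
  rewrite -setXTT product_measure1E// [X in (_ * X)%E](probability_setT unif) mule1.
  by rewrite ltey_eq fin_num_measure.
have iF : (m \x unif)%E.-integrable setT (EFin \o F) by exact: bounded_integrable.
have u1 : (@unif R setT < +oo)%E by rewrite probability_setT ltry.
have FE : fubini_F unif (EFin \o F) = EFin \o (fun x => \int[unif]_t F (x, t)).
  apply/funext => x; rewrite /fubini_F /Rintegral /= fineK//.
  apply: integrable_fin_num => //; apply: (bounded_integrable (C := C)) => //.
  exact: measurableT_comp.
split.
  by apply/measurable_EFinP; rewrite -FE; exact: (measurable_fubini_F iF).
rewrite /Rintegral -(integral12_prod_meas1 iF); congr fine.
by apply: eq_integral => x _; rewrite -[LHS]/(fubini_F unif (EFin \o F) x) FE.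
Qed.

End bounded_integrals.

(** * Disintegration of a law into a triple *)
(** The fibre over [x] is the law of [T (x, t)] for a uniform [t]. *)
Theorem disintegration_integral {R : realType} d0 (S : measurableType d0)
    (lam : {finite_measure set S -> \bar R}) d (P : measurableType d)
    (K : pseudoPMetricType R) (X : S -> P) (Y : S -> borel K)
    (mX : measurable_fun setT X) : compact [set: K] -> measurable_fun setT Y ->
  exists T : P * measurableTypeR R -> K,
    measurable_fun setT (T : _ -> borel K) /\
    forall (G : P * borel K -> R) (C : R), measurable_fun setT G ->
      (forall z, `|G z| <= C) ->
      measurable_fun setT (fun x => \int[unif]_t G (x, T (x, t))) /\
      \int[lam]_s G (X s, Y s) = \int[law lam mX]_x \int[unif]_t G (x, T (x, t)).
Proof.
move=> cK mY; have [E [oE sm]] := exists_coding cK.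
have mE i : measurable (E i : set (borel K)) by exact: sub_sigma_algebra.
have [T [mT lamT]] := disintegration lam cK sm mE mX mY.
exists T; split => // G C mG GC.
have mXY : measurable_fun setT (fun s => (X s, Y s) : P * borel K).
  exact: measurable_fun_pair.
have mxT : measurable_fun setT
    (fun xt : P * measurableTypeR R => (xt.1, T xt) : P * borel K).
  exact: measurable_fun_pair.
have lamfin : (lam setT < +oo)%E by rewrite ltey_eq fin_num_measure.
pose m : {measure set (P * measurableTypeR R)%type -> \bar R} :=
  (law lam mX \x unif)%E.
have mfin : (m setT < +oo)%E.
  rewrite /m /= -setXTT product_measure1E//.
  rewrite [X in (_ * X)%E](probability_setT unif) mule1.
  by rewrite ltey_eq fin_num_measure.
have mGT : measurable_fun setT (fun xt : P * measurableTypeR R => G (xt.1, T xt)).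
  exact: (measurableT_comp mG mxT).
have [H1 H2] := Rintegral_prod_unif (law lam mX) mGT (fun z => GC _).
split; first exact: H1.
rewrite -[RHS]H2 -(Rintegral_law mXY lamfin mG GC).
rewrite -[RHS](Rintegral_law mxT (mu := m) mfin mG GC).
congr fine; apply: eq_measure_integral => B mB _.
exact: lamT.
Qed.

Lemma compact_bound {R : realType} (Z : topologicalType) (D : set Z) (h : Z -> R) :
  compact D -> {within D, continuous h} ->
  exists2 C, 0 <= C & forall z, D z -> `|h z| <= C.
Proof.
move=> cD ch; have := @compact_bounded R R^o (h @` D) (continuous_compact ch cD).
move=> [M [_ HM]]; exists (`|M| + 1); first by rewrite addr_ge0.
by move=> z Dz; apply: (HM _ _ (h z)); [rewrite ltr_pwDr// ler_norm|exists z].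
Qed.

Lemma measurable_prod_coding {Z1 Z2 : Type} (E1 : nat -> set Z1)
    (E2 : nat -> set Z2) d (S : measurableType d) (A : set S) (f : S -> Z1 * Z2) i :
  (forall i, measurable (A `&` (fun s => (f s).1) @^-1` E1 i)) ->
  (forall i, measurable (A `&` (fun s => (f s).2) @^-1` E2 i)) ->
  measurable (A `&` f @^-1` prod_coding E1 E2 i).
Proof. by move=> m1 m2; rewrite /prod_coding; case: odd; [exact: m2|exact: m1]. Qed.

(** A law on the product of [D1], [KU] and [KR], given by a map [T] on [dom], is
    disintegrated first with respect to the pair of the first and third
    coordinates, then the law of that pair with respect to the first one. *)
Section triple_of_law.
Context {R : realType} (X1 KU KR : pseudoPMetricType R) (D1 : set X1).
Hypothesis clD1 : closed D1.
Hypothesis cO : compact D1.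
Hypothesis cU : compact [set: KU].
Hypothesis cR : compact [set: KR].

Local Notation Z := (X1 * KU * KR)%type.
Local Notation D := (D1 `*` [set: KU] `*` [set: KR]).

Context d0 (S : measurableType d0) (lam : {finite_measure set S -> \bar R}).
Context (dom : set S) (T : S -> Z).
Hypothesis mdom : measurable dom.
Hypothesis lamdom : lam (~` dom) = 0%E.
Hypothesis mT : measurable_fun setT (T : S -> borel Z).
Hypothesis TD : forall s, dom s -> D (T s).

Let mcont (Y : pseudoPMetricType R) (f : Z -> Y) : continuous f ->
  measurable_fun setT (f \o T : S -> borel Y).
Proof.
move=> /continuousP cf.
apply: (@measurability _ _ S (borel Y) setT (f \o T) (@open Y)) => //.
move=> _ [U oU <-]; rewrite setTI comp_preimage -[X in measurable X]setTI.
by apply: mT => //; apply: sub_sigma_algebra; exact: cf.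
Qed.

Let X s := (T s).1.1.
Let Y s := (T s).1.2.
Let W s := (T s).2.

Let mX : measurable_fun setT (X : S -> borel X1).
Proof.
have c : continuous (fun z : Z => z.1.1).
  by move=> x; apply: continuous_comp; exact: cvg_fst.
exact: (mcont c).
Qed.

Let mY : measurable_fun setT (Y : S -> borel KU).
Proof.
have c : continuous (fun z : Z => z.1.2).
  by move=> x; apply: continuous_comp; [exact: cvg_fst|exact: cvg_snd].
exact: (mcont c).
Qed.

Let mW : measurable_fun setT (W : S -> borel KR).
Proof.
have c : continuous (fun z : Z => z.2) by move=> x; exact: cvg_snd.
exact: (mcont c).
Qed.

Let XW s : borel X1 * borel KR := (X s, W s).

Let mXW : measurable_fun setT XW. Proof. exact: measurable_fun_pair. Qed.

Let cD : compact D.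
Proof. by apply: compact_setX => //; exact: compact_setX. Qed.

Local Notation P2 := (borel X1 * borel KR * borel KU)%type.
Let mclosure : measurable (D1 : set (borel X1)).
Proof.
rewrite -[D1]setCK; apply: measurableC; apply: sub_sigma_algebra.
exact: closed_openC.
Qed.

(* The disintegration lives on products of Borel spaces, but h is continuous on
   the product space, whose Borel sigma-algebra could be larger. The map swap
   is therefore shown to be Borel measurable, through the codes; this works
   over D1 only, where the first factor is compact. *)
Let A : set P2 := [set z | D1 z.1.1].
Let swap (z : P2) : Z := (z.1.1, z.2, z.1.2).

Let mA : measurable A.
Proof.
have m : measurable_fun setT (fun z : P2 => z.1.1).
  exact: measurableT_comp measurable_fst measurable_fst.
by rewrite -[X in measurable X]setTI; exact: m.
Qed.

Let measurable_swap : measurable_fun A (swap : P2 -> borel Z).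
Proof.
have [E1 [oE1 sm1]] := exists_coding cO.
have [EU [oEU smU]] := exists_coding cU.
have [ER [oER smR]] := exists_coding cR.
pose EZ := prod_coding (prod_coding E1 EU) ER.
have smZ : small_cells D EZ by exact: small_cells_prod (small_cells_prod sm1 smU) smR.
have pre (K : pseudoPMetricType R) (f : P2 -> borel K) (U : set K) :
    measurable_fun setT f -> open U -> measurable (A `&` f @^-1` U).
  move=> mf oU; apply: measurableI => //; rewrite -[X in measurable X]setTI.
  by apply: mf => //; exact: sub_sigma_algebra.
have m1 k : measurable (A `&` (fun z => (swap z).1.1) @^-1` E1 k).
  apply: (pre X1 (fun z => z.1.1) _ _ (oE1 k)).
  exact: measurableT_comp measurable_fst measurable_fst.
have m2 k : measurable (A `&` (fun z => (swap z).1.2) @^-1` EU k).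
  by apply: (pre KU (fun z => z.2) _ _ (oEU k)); exact: measurable_snd.
have m3 k : measurable (A `&` (fun z => (swap z).2) @^-1` ER k).
  apply: (pre KR (fun z => z.1.2) _ _ (oER k)).
  exact: measurableT_comp measurable_snd measurable_fst.
have m12 k : measurable (A `&` (fun z => (swap z).1) @^-1` prod_coding E1 EU k).
  exact: measurable_prod_coding m1 m2.
have m123 k : measurable (A `&` swap @^-1` EZ k) by exact: measurable_prod_coding m12 m3.
have mc b : measurable (A `&` [set z | code EZ (size b) (swap z) = b]).
  exact: measurable_code mA m123.
have cc z : coherent (code EZ ^~ (swap z)) by exact: coherent_code.
have fol z : A z -> follows D EZ (code EZ ^~ (swap z)) (swap z).
  by move=> Az; exact: follows_code.
have H := measurable_follows smZ cc mc fol.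
exact: H.
Qed.

Let cont_bound (K : pseudoPMetricType R) (h : K -> R) : compact [set: K] ->
  continuous h -> measurable_fun setT (h : borel K -> R) /\
                  exists C, forall z, `|h z| <= C.
Proof.
move=> cK ch; have ch' : {within setT, continuous h} by exact: continuous_subspaceT.
split; last first.
  by have [C _ hC] := compact_bound cK ch'; exists C => z; exact: hC.
have mid : measurable_fun setT (id : borel K -> borel K) by exact: measurable_id.
exact: (measurable_within_continuous ch' mid).
Qed.

Let sigma_closure : law lam mX (~` D1) = 0%E.
Proof.
have mC : measurable (X @^-1` (~` D1)).
  by rewrite -[X in measurable X]setTI; apply: mX => //; exact: measurableC.
apply: (subset_measure0 mC (measurableC mdom) _ lamdom).
by move=> s /= Xs /TD [[]].
Qed.

Theorem triple_of_law : exists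
    (sigma : {finite_measure set (borel X1) -> \bar R})
    (nu : X1 -> probability (borel KR) R)
    (mu : X1 -> KR -> probability (borel KU) R),
  [/\ sigma (~` D1) = 0%E,
      forall h : KR -> R, continuous h ->
        measurable_fun (D1 : set (borel X1)) (fun x => \int[nu x]_s h s),
      forall h : KU -> R, continuous h ->
        measurable_fun (D1 `*` setT : set (borel X1 * borel KR))
          (fun xs => \int[mu xs.1 xs.2]_r h r) &
      forall h : Z -> R, {within D, continuous h} ->
        \int[lam]_(s in dom) h (T s) =
        \int[sigma]_(x in D1) \int[nu x]_s \int[mu x s]_r h (x, r, s)].
Proof.
have [T1 [mT1 T1E]] := disintegration_integral lam mX cR mW.
have [T2 [mT2 T2E]] := disintegration_integral lam mXW cU mY.
have mT1x x : measurable_fun setT (fun t => T1 (x, t) : borel KR).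
  exact: measurableT_comp mT1 (measurable_pair1 x).
have mT2x xs : measurable_fun setT (fun t => T2 (xs, t) : borel KU).
  exact: measurableT_comp mT2 (measurable_pair1 xs).
have lamfin : (lam setT < +oo)%E by rewrite ltey_eq fin_num_measure.
have ufin : (@unif R setT < +oo)%E by rewrite probability_setT ltry.
have nuE x (f : borel KR -> R) C : measurable_fun setT f -> (forall s, `|f s| <= C) ->
    \int[law unif (mT1x x)]_s f s = \int[unif]_t f (T1 (x, t)).
  by move=> mf fC; exact: (Rintegral_law (mT1x x) ufin mf fC).
have muE xs (f : borel KU -> R) C : measurable_fun setT f -> (forall s, `|f s| <= C) ->
    \int[law unif (mT2x xs)]_s f s = \int[unif]_t f (T2 (xs, t)).
  by move=> mf fC; exact: (Rintegral_law (mT2x xs) ufin mf fC).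
pose nu x : probability (borel KR) R := law unif (mT1x x).
pose mu x s : probability (borel KU) R := law unif (mT2x (x, s)).
have nu_meas (h : KR -> R) : continuous h ->
    measurable_fun (D1 : set (borel X1)) (fun x => \int[nu x]_s h s).
  move=> ch; have [mh [C hC]] := cont_bound cR ch.
  have mG : measurable_fun setT (fun z : borel X1 * borel KR => h z.2).
    exact: measurableT_comp mh measurable_snd.
  have [+ _] := T1E _ C mG (fun z => hC z.2).
  move=> mI; apply: measurable_funTS; rewrite (_ : (fun x => _) =
    (fun x : borel X1 => \int[unif]_t h (T1 (x, t)))) //.
  by apply/funext => x; exact: (nuE x h C mh hC).
have mu_meas (h : KU -> R) : continuous h ->
    measurable_fun (D1 `*` setT : set (borel X1 * borel KR))
      (fun xs => \int[mu xs.1 xs.2]_r h r).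
  move=> ch; have [mh [C hC]] := cont_bound cU ch.
  have mG : measurable_fun setT (fun z : P2 => h z.2).
    exact: measurableT_comp mh measurable_snd.
  have [+ _] := T2E _ C mG (fun z => hC z.2).
  move=> mI; apply: measurable_funTS; rewrite (_ : (fun xs => _) =
    (fun xs : borel X1 * borel KR => \int[unif]_t h (T2 (xs, t)))) //.
  by apply/funext => -[x s]; exact: (muE (x, s) h C mh hC).
exists (law lam mX), nu, mu; split.
- exact: sigma_closure.
- exact: nu_meas.
- exact: mu_meas.
move=> h ch.
pose H : P2 -> R := (fun z => h (swap z)) \_ A.
have mH : measurable_fun setT H.
  have AD z : A z -> D (swap z) by move=> Az.
  have mh := measurable_within_continuous ch measurable_swap AD.
  exact/(measurable_restrictT _ mA).
have [C C0 hC] := compact_bound cD ch.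
have HC z : `|H z| <= C.
  rewrite /H patchE; case: ifPn => [/set_mem Az|_]; last by rewrite normr0.
  exact: hC.
have [mG1 E1] := T2E _ C mH HC.
pose G1 xs := \int[unif]_t H (xs, T2 (xs, t)).
have G1C xs : `|G1 xs| <= C.
  apply: Rintegral_bound => //; apply: measurableT_comp mH _.
  exact: measurable_fun_pair.
have [mG2 E2] := T1E G1 C mG1 G1C.
(* Outside A the function H vanishes, and T avoids it outside a null set. *)
have L1 : \int[lam]_(s in dom) h (T s) = \int[lam]_s H (XW s, Y s).
  have mHT : measurable_fun setT (fun s => H (XW s, Y s)).
    by apply: measurableT_comp mH _; exact: measurable_fun_pair.
  have iHT := bounded_integrable lamfin mHT (fun s => HC _).
  rewrite /Rintegral (negligible_integral (measurableC mdom) measurableT iHT lamdom).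
  rewrite setTD setCK; congr fine; apply: eq_integral => s /set_mem ds.
  have [[D1s _] _] := TD ds.
  rewrite /H /= patchE mem_set//; congr (h _)%:E.
  by rewrite /swap /XW /X /Y /W /=; case: (T s) => [[]].
rewrite L1 E1 (Rintegral_law mXW lamfin mG1 G1C) E2.
rewrite [RHS]Rintegral_mkcond /=; apply: eq_Rintegral => x _.
rewrite patchE; case: ifPn => [/set_mem xO|xO].
  have HE s r : H ((x, s), r) = h (x, r, s).
    by rewrite /H patchE mem_set.
  have mGx : measurable_fun setT (fun s : borel KR => G1 (x, s)).
    exact: measurableT_comp mG1 (measurable_pair1 x).
  rewrite -(nuE x _ C mGx (fun s => G1C _)); apply: eq_Rintegral => s _.
  have mHx : measurable_fun setT (fun r : borel KU => H ((x, s), r)).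
    exact: measurableT_comp mH (measurable_pair1 _).
  rewrite /G1 -(muE (x, s) _ C mHx (fun r => HC _)).
  by apply: eq_Rintegral => r _; exact: HE.
have H0 s r : H ((x, s), r) = 0.
  by rewrite /H patchE memNset// => Ax; move: xO; rewrite mem_set.
have G0 s : G1 (x, s) = 0.
  rewrite /G1 (@eq_Rintegral _ _ _ _ _ (cst 0)); last by move=> t _; exact: H0.
  by rewrite Rintegral_cst// mul0r.
rewrite (@eq_Rintegral _ _ _ _ _ (cst 0)); last by move=> t _; exact: G0.
by rewrite Rintegral_cst// mul0r.
Qed.

End triple_of_law.

(** * Weak compactness *)
(** The sequence has a cluster point [a] in the compact product of intervals; the
    k-th index is chosen so that the first [k] coordinates are 1/(k+1)-close to
    those of [a]. *)
Lemma diagonal_subsequence {R : realType} (I : countType) (u : nat -> I -> R)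
    (M : R) : (forall k i, `|u k i| <= M) ->
  exists (phi : nat -> nat) (a : I -> R), {homo phi : i j / (i < j)%N} /\
    forall i, (fun k => u (phi k) i) @ \oo --> a i.
Proof.
move=> uM; pose K (i : I) : set R := [set` `[- M, M]].
have cK : compact [set f : prod_topology (fun _ : I => R) | forall i, K i (f i)].
  by apply: tychonoff => i; exact: segment_compact.
have [|a [Ka clu]] := cK ((u : nat -> prod_topology (fun _ : I => R)) @ \oo) _.
  by exists 0%N => // k _ i; rewrite /K /= in_itv /= -ler_norml.
pose ok j k := forall i, (pickle i < j)%N -> `|a i - u k i| < j.+1%:R^-1.
have next N j : exists k, (N <= k)%N /\ ok j k.
  pose Bn (n : 'I_j) : set (prod_topology (fun _ : I => R)) := [set f |
    if unpickle n is Some i then `|a i - f i| < j.+1%:R^-1 else true].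
  have nBn n : nbhs a (Bn n).
    rewrite /Bn; case: (unpickle n) => [i|]; last exact: filterE.
    have pa : (fun f : prod_topology (fun _ : I => R) => f i : R) @ a --> (a i : R).
      exact: (@proj_continuous I (fun _ : I => R) i a).
    have j0 : 0 < j.+1%:R^-1 :> R by rewrite invr_gt0.
    exact: ((cvgrPdist_lt _ _).1 pa _ j0).
  have nB := filter_forall (nbhs_filter a) nBn.
  have nA : (u @ \oo) [set f | exists2 k, (N <= k)%N & f = u k].
    by exists N => // k /= Nk; exists k.
  have [f [[k Nk ->] Bk]] := clu _ _ nA nB; exists k; split => // i ij.
  by have := Bk (Ordinal ij); rewrite /Bn /= pickleK.
pose g N j := sval (cid (next N j)).
have gP N j : (N <= g N j)%N /\ ok j (g N j) by rewrite /g; case: cid.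
pose phi := fix phi k := if k is k'.+1 then g (phi k').+1 k else g 0%N 0%N.
exists phi, a; split.
  apply: homo_ltn => [|k]; first exact: ltn_trans.
  by have [] := gP (phi k).+1 k.+1.
have okphi k : ok k (phi k).
  by case: k => [|k]; [have [] := gP 0%N 0%N|have [] := gP (phi k).+1 k.+1].
move=> i; apply/cvgrPdist_lt => e e0.
have [N _ NP] := near_infty_natSinv_lt (PosNum e0).
near=> k; apply: (lt_trans (okphi k i _)); first by near: k; exact: nbhs_infty_gt.
by apply: NP => /=; near: k; exact: nbhs_infty_ge.
Unshelve. all: by end_near.
Qed.

(** Two families of densities, indexed by [bool], are carried along so that one
    subsequence serves both of them. *)
Section weak_compactness.
Context {R : realType} (X1 KU KR : pseudoPMetricType R) (D1 : set X1).
Hypothesis clD1 : closed D1.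
Hypothesis cD1 : compact D1.
Hypothesis cU : compact [set: KU].
Hypothesis cR : compact [set: KR].

Local Notation Z := (X1 * KU * KR)%type.
Local Notation D := (D1 `*` [set: KU] `*` [set: KR]).

Context d (S : measurableType d) (mu : {measure set S -> \bar R}) (A : set S).
Context (y : nat -> S -> Z) (rho : bool -> nat -> S -> R) (M : R).
Hypothesis mA : measurable A.
Hypothesis my1 : forall k, measurable_fun A (fun s => (y k s).1.1 : borel X1).
Hypothesis my2 : forall k, measurable_fun A (fun s => (y k s).1.2 : borel KU).
Hypothesis my3 : forall k, measurable_fun A (fun s => (y k s).2 : borel KR).
Hypothesis yD : forall k s, A s -> D1 (y k s).1.1.
Hypothesis rho0 : forall r k s, A s -> 0 <= rho r k s.
Hypothesis irho : forall r k, mu.-integrable A (EFin \o rho r k).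
Hypothesis rhoM : forall r k, \int[mu]_(s in A) rho r k s <= M.

Theorem weak_compactness : exists phi : nat -> nat,
  {homo phi : i j / (i < j)%N} /\
  forall r, exists
    (sigma : {finite_measure set (borel X1) -> \bar R})
    (nu : X1 -> probability (borel KR) R)
    (mu' : X1 -> KR -> probability (borel KU) R),
  [/\ sigma (~` D1) = 0%E,
      forall h : KR -> R, continuous h ->
        measurable_fun (D1 : set (borel X1)) (fun x => \int[nu x]_s h s),
      forall h : KU -> R, continuous h ->
        measurable_fun (D1 `*` setT : set (borel X1 * borel KR))
          (fun xs => \int[mu' xs.1 xs.2]_r h r) &
      forall h : Z -> R, {within D, continuous h} ->
        (forall k, mu.-integrable A (EFin \o (fun s => h (y k s) * rho r k s))) /\
        (fun k => \int[mu]_(s in A) (h (y (phi k) s) * rho r (phi k) s)) @ \oo -->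
        \int[sigma]_(x in D1) \int[nu x]_s \int[mu' x s]_r h (x, r, s)].
Proof.
have [E1 [oE1 sm1]] := exists_coding cD1.
have [EU [oEU smU]] := exists_coding cU.
have [ER [oER smR]] := exists_coding cR.
pose E := prod_coding (prod_coding E1 EU) ER.
have sm : small_cells D E by exact: small_cells_prod (small_cells_prod sm1 smU) smR.
have cD : compact D by apply: compact_setX => //; exact: compact_setX.
have yDZ k s : A s -> D (y k s) by move=> As; split => //; split => //; exact: yD.
have pre (K : pseudoPMetricType R) (f : S -> borel K) (U : set K) :
    measurable_fun A f -> open U -> measurable (A `&` f @^-1` U).
  by move=> mf oU; apply: mf => //; exact: sub_sigma_algebra.
have mE k i : measurable (A `&` y k @^-1` E i).
  apply: measurable_prod_coding => {}i; last exact: (pre _ _ _ (my3 k) (oER i)).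
  apply: (measurable_prod_coding (f := fun s => (y k s).1)) => {}i.
    exact: (pre _ _ _ (my1 k) (oE1 i)).
  exact: (pre _ _ _ (my2 k) (oEU i)).
have my k b : measurable (A `&` [set s | code E (size b) (y k s) = b]).
  exact: measurable_code mA (mE k).
(* The masses of all the cells, for both densities at once. *)
pose u k (rb : bool * seq bool) :=
  \int[mu]_(s in A `&` [set s | code E (size rb.2) (y k s) = rb.2]) rho rb.1 k s.
have uM k rb : `|u k rb| <= M.
  case: rb => r b; rewrite ger0_norm; last by apply: Rintegral_ge0 => s [/rho0].
  have mb := my k b; have ib := irho r k.
  apply: le_trans (rhoM r k); apply: fine_le.
  - have := integrable_fin_num mb (integrableS mA mb _ ib).
    by apply => s [].
  - exact: (integrable_fin_num mA ib).
  have rE s : A s -> (0 <= (EFin \o rho r k) s)%E.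
    by move=> As; rewrite lee_fin; exact: rho0.
  have := ge0_subset_integral mu mb mA (measurable_int _ ib) rE.
  by apply => s [].
have [phi [a [phiS ua]]] := diagonal_subsequence uM.
exists phi; split => // r.
have ra b : (fun k => \int[mu]_(s in A `&` [set s | code E (size b) (y (phi k) s) = b])
    rho r (phi k) s) @ \oo --> a (r, b) by exact: (ua (r, b)).
have [lam [dom [T [mdom lam0 mT TD limT]]]] := weak_limit (y := y \o phi)
  (rho := rho r \o phi) (a := fun b => a (r, b)) cD sm mA (fun k => yDZ (phi k))
  (fun k => my (phi k)) (fun k => @rho0 r (phi k)) (fun k => irho r (phi k)) ra.
have [sigma [nu [mu' [H1 H2 H3 H4]]]] := triple_of_law clD1 cD1 cU cR mdom lam0 mT TD.
exists sigma, nu, mu'; split => // h ch.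
split; last by rewrite -H4//; exact: limT.
move=> k; have [j jP] := coded_approx cD sm ch ltr01.
by have [] := jP _ _ mu A (fun s => code E ^~ (y k s)) (y k) (rho r k) mA
  (fun s => coherent_code E (y k s)) (my k)
  (fun s As => follows_code E (yDZ k s As)) (@rho0 r k) (irho r k).
Qed.

End weak_compactness.

(** * The densities 1 + |v|^r *)
Section densities.
Context {R : realType}.

Lemma measurable_enorm d (S : measurableType d) (a b : nat) (A : set S)
    (f : S -> 'M[R]_(a, b)) :
  measurable_fun A (f : S -> borel 'M[R]_(a, b)) ->
  measurable_fun A (fun s => enorm (f s)).
Proof.
move=> mf.
have mij i j : measurable_fun A (fun s => f s i j).
  move=> mA; apply: (@measurability _ _ S R A _ _ (RGenOpens.measurableE R)) => //.
  move=> _ [_ [x [z ->]] <-].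
  have oU : open ((fun M : 'M[R]_(a, b) => M i j) @^-1` [set` `]x, z[]).
    have /continuousP := @coord_continuous R a b i j.
    by apply; exact: interval_open.
  have mU : measurable ((fun M : 'M[R]_(a, b) => M i j) @^-1` [set` `]x, z[]
      : set (borel 'M[R]_(a, b))) by exact: sub_sigma_algebra.
  exact: (mf mA _ mU).
have msqrt : measurable_fun setT (@Num.sqrt R).
  by apply: continuous_measurable_fun; exact: sqrt_continuous.
apply: (measurableT_comp msqrt); apply: measurable_sum => i.
by apply: measurable_sum => j; exact: measurable_funX.
Qed.

(** A bounded set lies in a cube, whose Lebesgue measure is a product of
    lengths. *)
Lemma lebesgue_rV_bounded n (Omega : set 'rV[R]_n) :
  bounded_set Omega -> (1 <= n)%N -> measurable (Omega : set (borel 'rV[R]_n)) ->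
  (lebesgue_rV n Omega < +oo)%E.
Proof.
move=> [B [_ HB]] n1 mO; pose C := `|B| + 1.
have C0 : 0 <= C by rewrite addr_ge0.
pose box := [set v : 'rV[R]_n | forall i, [set` `[- C, C]] (v 0 i)].
have Obox : Omega `<=` box.
  move=> v Ov i; rewrite /= in_itv /= -ler_norml.
  have vC : `|v| <= C by apply: HB Ov; rewrite ltr_pwDr// ler_norm.
  apply: le_trans vC; rewrite /Num.norm /= mx_normrE.
  exact: (le_bigmax _ (fun ij => `|v ij.1 ij.2|) (0, i)).
have boxE := lebesgue_rV_box (fun i : 'I_n => measurable_itv `[- C, C]).
have mbox : measurable (box : set (borel 'rV[R]_n)).
  rewrite (_ : box = \bigcap_(i in [set: 'I_n])
      ((fun v : borel 'rV[R]_n => (v : 'rV[R]_n) 0 i) @^-1` [set` `[- C, C]])).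
    apply: fin_bigcap_measurable => // i _.
    by rewrite -[X in measurable X]setTI; exact: measurable_coord.
  by apply/seteqP; split => v /= h i; [move=> _|]; exact: h.
apply: (@le_lt_trans _ _ (lebesgue_rV n box)).
  by apply: le_measure => //; rewrite inE.
have CE : lebesgue_measure [set` `[- C, C]] = (C + C)%:E.
  rewrite lebesgue_measure_itv/= lte_fin.
  by case: ltP => h; rewrite -?EFinB ?opprK//; congr EFin; lra.
by rewrite boxE (eq_bigr (fun=> (C + C)%:E)) ?prodEFin ?ltry// => i _; exact: CE.
Qed.

(** The integral of [enorm (v k x) `^ r] is the [r]-th power of the norm of
    [v k], and the constant 1 contributes the measure of [Omega]. *)
Lemma density_bounded n a b (Omega : set 'rV[R]_n) (r : R)
    (v : nat -> 'rV[R]_n -> 'M[R]_(a, b)) :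
  measurable (Omega : set (borel 'rV[R]_n)) -> (lebesgue_rV n Omega < +oo)%E ->
  1 <= r -> bounded_in_Lp Omega r v ->
  exists M : R, forall k,
    (lebesgue_rV n).-integrable (Omega : set (borel 'rV[R]_n))
       (EFin \o (fun x => 1 + enorm (v k x) `^ r)) /\
    \int[lebesgue_rV n]_(x in Omega) (1 + enorm (v k x) `^ r) <= M.
Proof.
move=> mO fO r1 [mv [M HM]].
have r0 : r != 0 by rewrite gt_eqF//; lra.
pose g k (x : borel 'rV[R]_n) := enorm (v k x) `^ r.
have g0 k x : 0 <= g k x by exact: powR_ge0.
have mg k : measurable_fun (Omega : set (borel 'rV[R]_n)) (g k).
  exact: (measurableT_comp (measurable_powR r) (measurable_enorm (mv k))).
have gM k : (\int[lebesgue_rV n]_(x in Omega) (g k x)%:E <= (`|M| `^ r)%:E)%E.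
  have := HM k; set N := Lnorm _ _ _ => NM.
  have NE : (N `^ r = \int[lebesgue_rV n]_(x in Omega) (g k x)%:E)%E.
    rewrite /N poweR_Lnorm// [RHS]integral_mkcond; apply: eq_integral => x _.
    rewrite !patchE; case: ifPn => _; last by rewrite abse0 poweR0r.
    by rewrite abse_EFin poweR_EFin ger0_norm// sqrtr_ge0.
  rewrite -NE -poweR_EFin; apply: gt0_ler_poweR => //.
  - by lra.
  - by rewrite in_itv /= leey andbT Lnorm_ge0.
  - by rewrite in_itv /= leey andbT lee_fin.
  - by rewrite (le_trans NM)// lee_fin ler_norm.
pose C : \bar R := (lebesgue_rV n Omega + (`|M| `^ r)%:E)%E.
have Cfin : (C < +oo)%E by rewrite lte_add_pinfty// ltry.
have dE k : (\int[lebesgue_rV n]_(x in Omega) (1 + g k x)%:E <= C)%E.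
  under eq_integral do rewrite EFinD.
  rewrite ge0_integralD//; last 2 first.
  - by move=> x _; rewrite lee_fin.
  - exact/measurable_EFinP.
  by rewrite integral_cst// mul1e leeD2l.
have di k : (lebesgue_rV n).-integrable (Omega : set (borel 'rV[R]_n))
       (EFin \o (fun x => 1 + g k x)).
  apply/integrableP; split; first exact/measurable_EFinP/measurable_funD.
  under eq_integral do rewrite /= ger0_norm ?addr_ge0//.
  exact: le_lt_trans (dE k) Cfin.
exists (fine C) => k; split; first exact: di.
apply: fine_le.
- exact: integrable_fin_num (di k).
- by rewrite ge0_fin_numE// adde_ge0// lee_fin powR_ge0.
- exact: dE.
Qed.

End densities.

(** * Generation of the measures *)
Lemma compactification_continuous {R : realType} (E : topologicalType)
    (K : pseudoPMetricType R) (e : E -> K) : metrizable_compactification e ->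
  continuous e.
Proof.
move=> [_ _ _ oe _]; apply/continuousP => V oV.
by apply/oe; exists V.
Qed.

Lemma extensionP {R : realType} (E : topologicalType) (A : set (E -> R))
    (K : pseudoPMetricType R) (e : E -> K) (f : E -> R) :
  compactification_of A e -> A f ->
  continuous (extension e f) /\ extension e f \o e = f.
Proof.
move=> [_ AE] /AE[F cF Fe].
by apply: (xgetPex (cst 0) (P := [set F : K -> R | continuous F /\ F \o e = f])); exists F.
Qed.

Lemma measurable_continuous_comp d (S : measurableType d) (Y1 Y2 : ptopologicalType)
    (A : set S) (f : S -> Y1) (e : Y1 -> Y2) : continuous e ->
  measurable_fun A (f : S -> borel Y1) -> measurable_fun A (e \o f : S -> borel Y2).
Proof.
move=> /continuousP ce mf mA.
apply: (@measurability _ _ S (borel Y2) A _ (@open Y2)) => //.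
move=> _ [V oV <-].
have mV : measurable (e @^-1` V : set (borel Y1)).
  by apply: sub_sigma_algebra; exact: ce.
exact: (mf mA _ mV).
Qed.

Lemma within_continuous_prod3 {R : realType} (X1 X2 X3 : topologicalType) (D : set X1)
    (g : X1 -> R) (F : X2 -> R) (G : X3 -> R) :
  {within D, continuous g} -> continuous F -> continuous G ->
  {within D `*` setT `*` setT,
    continuous (fun z : X1 * X2 * X3 => g z.1.1 * F z.1.2 * G z.2)}.
Proof.
move=> /subspace_continuousP cg cF cG; apply/subspace_continuousP => z [[Dz _] _].
have c1 : (fun x : X1 * X2 * X3 => x.1.1) @ nbhs z --> z.1.1.
  exact: cvg_comp (@cvg_fst _ _ (nbhs z.1) (nbhs z.2) _) (@cvg_fst _ _ (nbhs z.1.1) (nbhs z.1.2) _).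
have c2 : (fun x : X1 * X2 * X3 => x.1.2) @ nbhs z --> z.1.2.
  exact: cvg_comp (@cvg_fst _ _ (nbhs z.1) (nbhs z.2) _) (@cvg_snd _ _ (nbhs z.1.1) (nbhs z.1.2) _).
apply: cvgM; first apply: cvgM.
- move=> B /(cg _ Dz)/c1 nB.
  by apply: (@filterS _ (nbhs z) _ _ _ _ nB) => x Bx [[Dx _] _]; exact: Bx.
- apply: cvg_within_filter; exact: cvg_comp c2 (cF _).
- apply: cvg_within_filter; exact: cvg_comp (@cvg_snd _ _ (nbhs z.1) (nbhs z.2) _) (cG _).
Qed.

Lemma bounded_closure {R : realType} (V : normedModType R) (A : set V) :
  bounded_set A -> bounded_set (closure A).
Proof.
move=> [M [Mr HM]]; exists M; split => // x Mx y.
have cl : closed [set y : V | `|y| <= x].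
  by apply: (closed_comp (f := fun y : V => `|y|)) (@closed_le _ x) => z _; exact: norm_continuous.
have := closure_subset (HM x Mx : A `<=` [set y | `|y| <= x]).
by rewrite -((closure_id _).1 cl); apply.
Qed.

(** Weak compactness for the maps [y k] and the densities [rho true], which gives
    the p-sense, and [rho false], which gives the q-sense. *)
Theorem theorem6 (R : realType) (m n : nat) (m_ge1 : (1 <= m)%N)
    (n_ge1 : (1 <= n)%N)
    (Omega : set 'rV[R]_n) (Omega_dom : bounded_lipschitz_domain Omega)
    (ringU : set ('rV[R]_m -> R)) (U_ring : complete_ring ringU)
    (U_sep : separable_ring ringU)
    (KU : pseudoPMetricType R) (eU : 'rV[R]_m -> KU)
    (U_comp : compactification_of ringU eU)
    (ringR : set ('M[R]_(m, n) -> R)) (R_ring : complete_ring ringR)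
    (R_sep : separable_ring ringR)
    (KR : pseudoPMetricType R) (eR : 'M[R]_(m, n) -> KR)
    (R_comp : compactification_of ringR eR)
    (p q : R) (q_ge1 : 1 <= q) (p_ge1 : 1 <= p)
    (u : nat -> 'rV[R]_n -> 'rV[R]_m) (u_bnd : bounded_in_Lp Omega q u)
    (w : nat -> 'rV[R]_n -> 'M[R]_(m, n)) (w_bnd : bounded_in_Lp Omega p w) :
  exists (phi : nat -> nat) (t ts : measure_triple Omega KU KR),
    [/\ {homo phi : i j / (i < j)%N},
        generates_p ringU ringR eU eR (u \o phi) (w \o phi) p t,
        generates_q ringU ringR eU eR (u \o phi) (w \o phi) q ts &
        forall h1 h2 : 'rV[R]_n * KU * KR -> R,
          {within closure Omega `*` setT `*` setT, continuous h1} ->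
          {within closure Omega `*` setT `*` setT, continuous h2} ->
          (fun k => \int[lebesgue_rV n]_(x in Omega)
             (h1 (x, eU (u (phi k) x), eR (w (phi k) x)) *
                (1 + enorm (w (phi k) x) `^ p) +
              h2 (x, eU (u (phi k) x), eR (w (phi k) x)) *
                (1 + enorm (u (phi k) x) `^ q)))
            @ \oo -->
          triple_integral t (fun x r s => h1 (x, r, s)) +
          triple_integral ts (fun x r s => h2 (x, r, s))].
Proof.
have [_ oO _ bO _] := Omega_dom.
have mO : measurable (Omega : set (borel 'rV[R]_n)) by exact: sub_sigma_algebra.
have fO := lebesgue_rV_bounded bO n_ge1 mO.
have [Mp HMp] := density_bounded mO fO p_ge1 w_bnd.
have [Mq HMq] := density_bounded mO fO q_ge1 u_bnd.
have cU : compact [set: KU] by case: U_comp => -[].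
have cR : compact [set: KR] by case: R_comp => -[].
have ceU := compactification_continuous U_comp.1.
have ceR := compactification_continuous R_comp.1.
have clO : closed (closure Omega : set 'rV[R]_n) by exact: closed_closure.
have cO : compact (closure Omega).
  by apply: bounded_closed_compact => //; exact: bounded_closure.
pose y k (x : borel 'rV[R]_n) := ((x : 'rV[R]_n), eU (u k x), eR (w k x)).
pose rho (r : bool) k (x : borel 'rV[R]_n) :=
  if r then 1 + enorm (w k x) `^ p else 1 + enorm (u k x) `^ q.
have rho0 r k x : Omega x -> 0 <= rho r k x.
  by move=> _; case: r; rewrite addr_ge0// powR_ge0.
have irho r k : (lebesgue_rV n).-integrable (Omega : set (borel 'rV[R]_n)) (EFin \o rho r k).
  by case: r; [have [] := HMp k|have [] := HMq k].
have rhoM r k : \int[lebesgue_rV n]_(x in Omega) rho r k x <= Num.max Mp Mq.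
  by rewrite le_max; case: r; apply/orP; [left; have [] := HMp k|right; have [] := HMq k].
have my1 k : measurable_fun (Omega : set (borel 'rV[R]_n)) (fun x => (y k x).1.1 : borel 'rV[R]_n).
  exact: measurable_id.
have my2 k : measurable_fun (Omega : set (borel 'rV[R]_n)) (fun x => (y k x).1.2 : borel KU).
  exact: (measurable_continuous_comp ceU (u_bnd.1 k)).
have my3 k : measurable_fun (Omega : set (borel 'rV[R]_n)) (fun x => (y k x).2 : borel KR).
  exact: (measurable_continuous_comp ceR (w_bnd.1 k)).
have yD k x : Omega x -> closure Omega (y k x).1.1.
  by move=> Ox; exact: subset_closure.
have [phi [phiS H]] := weak_compactness (X1 := 'rV[R]_n) (y := y) clO cO cU cR mO my1 my2 my3 yD
  rho0 irho rhoM.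
have [sp [nup [mup [p1 p2 p3 p4]]]] := H true.
have [sq [nuq [muq [q1 q2 q3 q4]]]] := H false.
pose t := @MeasureTriple R n Omega KU KR sp nup mup p1 p2 p3.
pose ts := @MeasureTriple R n Omega KU KR sq nuq muq q1 q2 q3.
exists phi, t, ts; split => //.
- move=> g f0 psi0 cg Uf0 Rpsi0.
  have [cF FE] := extensionP U_comp Uf0; have [cG GE] := extensionP R_comp Rpsi0.
  have [_] := p4 _ (within_continuous_prod3 cg cF cG).
  rewrite /triple_integral (_ : (fun k => _) = (fun k => \int[lebesgue_rV n]_(x in Omega)
     (g x * f0 (u (phi k) x) * (psi0 (w (phi k) x) * (1 + enorm (w (phi k) x) `^ p))))) //.
  apply/funext => k; apply: eq_Rintegral => x _.
  by rewrite mulrA -{2}FE -{2}GE.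
- move=> g f0 psi0 cg Uf0 Rpsi0.
  have [cF FE] := extensionP U_comp Uf0; have [cG GE] := extensionP R_comp Rpsi0.
  have [_] := q4 _ (within_continuous_prod3 cg cF cG).
  rewrite /triple_integral (_ : (fun k => _) = (fun k => \int[lebesgue_rV n]_(x in Omega)
     (g x * (f0 (u (phi k) x) * (1 + enorm (u (phi k) x) `^ q)) * psi0 (w (phi k) x)))) //.
  apply/funext => k; apply: eq_Rintegral => x _.
  by rewrite mulrA mulrAC -{2}FE -{2}GE.
move=> h1 h2 ch1 ch2.
have [i1 l1] := p4 h1 ch1.
have [i2 l2] := q4 h2 ch2.
rewrite /triple_integral.
suff -> : (fun k => \int[lebesgue_rV n]_(x in Omega)
  (h1 (x, eU (u (phi k) x), eR (w (phi k) x)) * (1 + enorm (w (phi k) x) `^ p) +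
   h2 (x, eU (u (phi k) x), eR (w (phi k) x)) * (1 + enorm (u (phi k) x) `^ q))) =
  (fun k => \int[lebesgue_rV n]_(x in Omega) (h1 (y (phi k) x) * rho true (phi k) x)) +
  (fun k => \int[lebesgue_rV n]_(x in Omega) (h2 (y (phi k) x) * rho false (phi k) x)).
  exact: cvgD l1 l2.
by apply/funext => k; exact: (RintegralD mO (i1 (phi k)) (i2 (phi k))).
Qed.
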